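(* Let $G\sim\mathrm{SBM}(n,q,a,b)$ with $a\le \frac n2$. Suppose that there exist constants $\varepsilon,\delta,\eta>0$ such that $q\le n^{1/2-\varepsilon}$, $a\ge\delta b$, and $$\mathrm{SNR}\equiv\frac{(a-b)^2}{q\left(a(1-a/n)+(q-1)b(1-b/n)\right)}\le 1-\eta.$$ Then there exist constants $c\equiv c(\delta,\eta)>0$ and $C\equiv C(\eta)>0$ such that if $D\le n^{c\,\varepsilon}$ then $$\mathrm{Corr}_{\le D}\le C\sqrt{\frac qn}.$$
   Context: Stochastic block model $\mathrm{SBM}(n,q,a,b)$: $q\ge2$ is an integer, $a,b>0$; all parameters may depend on $n$ (no sparsity is assumed). Each vertex $u\in[n]$ receives a community $\sigma^\star_u\in[q]$ independently and uniformly at random; given $\sigma^\star$, each possible edge $\{u,v\}$ is included independently with probability $a/n$ if $\sigma^\star_u=\sigma^\star_v$ and $b/n$ otherwise. The graph is encoded by $Y=(Y_{ij})_{1\le i<j\le n}\in\{0,1\}^{\binom n2}$, $Y_{ij}=1$ iff $\{i,j\}$ is an edge. Let $\mathbb R[Y]_{\le D}$ be the set of real multivariate polynomials of degree at most $D$ in the variables $Y_{ij}$. The degree-$D$ correlation is $$\mathrm{Corr}_{\le D}:=\sup_{f\in\mathbb R[Y]_{\le D}}\frac{\mathbb E[f(Y)\cdot x]}{\sqrt{\mathbb E[f(Y)^2]\cdot\mathbb E[x^2]}},\qquad x:=\mathbf 1\{\sigma^\star_1=\sigma^\star_2\}-\frac1q,$$ with expectations over the joint law of $(\sigma^\star,Y)$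 (and $f$ ranging over polynomials with $\mathbb E[f(Y)^2]\neq0$). *)

(* Defs.v *)
From mathcomp Require Import all_boot all_order all_algebra.
From mathcomp Require Import classical_sets reals ereal exp.
(* The notations of [mpoly] clash with those of the analysis library. *)
From mathcomp Require mpoly.
Import -(notations) mpoly.

Set Implicit Arguments.
Unset Strict Implicit.
Unset Printing Implicit Defensive.

Import Order.TTheory GRing.Theory Num.Theory.

Local Open Scope classical_set_scope.
Local Open Scope ring_scope.

Definition edge (n : nat) : finType := {e : 'I_n * 'I_n | (e.1 < e.2)%N}.

Definition labeling (n q : nat) : finType := {ffun 'I_n -> 'I_q}.

Definition graph (n : nat) : finType := {ffun edge n -> bool}.

(* The joint law of the communities and the graph lives on this finite space. *)
Definition outcome (n q : nat) : finType := (labeling n q * graph n)%type.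

Definition edge_prob (R : realType) (n q : nat) (a b : R)
    (sigma : labeling n q) (e : edge n) : R :=
  if sigma (val e).1 == sigma (val e).2 then a / n%:R else b / n%:R.

Definition sbm_pmf (R : realType) (n q : nat) (a b : R)
    (w : outcome n q) : R :=
  (\prod_(u < n) q%:R^-1) *
  \prod_(e : edge n) (if w.2 e then edge_prob a b w.1 e
                      else 1 - edge_prob a b w.1 e).

Definition sbm_expect (R : realType) (n q : nat) (a b : R)
    (X : outcome n q -> R) : R :=
  \sum_(w : outcome n q) sbm_pmf a b w * X w.

(* Real polynomials in the variables Y_e; variable number k is the edge
   [enum_val k]. *)
Definition edge_poly (R : realType) (n : nat) : Type :=
  mpoly.mpoly #|{: edge n}| R.

Definition edge_poly_eval (R : realType) (n : nat) (f : edge_poly R n)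
    (Y : graph n) : R :=
  mpoly.meval (fun k => (Y (enum_val k))%:R) f.

(* [mpoly.msize f] is 0 when f = 0, and one plus the total degree otherwise. *)
Definition edge_poly_degree_le (R : realType) (n D : nat)
    (f : edge_poly R n) : Prop :=
  (mpoly.msize f <= D.+1)%N.

Definition same_community (R : realType) (n q : nat) (u v : 'I_n)
    (w : outcome n q) : R :=
  (w.1 u == w.1 v)%:R - q%:R^-1.

(* The supremum is taken in the extended reals, so that it is the least upper
   bound with no default value involved. *)
Definition corr_le (R : realType) (n q : nat) (a b : R) (D : nat)
    (u v : 'I_n) : \bar R :=
  let E := @sbm_expect R n q a b in
  let x := @same_community R n q u v in
  let ev (f : edge_poly R n) (w : outcome n q) := edge_poly_eval f w.2 in
  ereal_sup
    [set (E (fun w => ev f w * x w) /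
          Num.sqrt (E (fun w => ev f w ^+ 2) * E (fun w => x w ^+ 2)))%:E
    | f in [set f : edge_poly R n |
            edge_poly_degree_le D f /\ E (fun w => ev f w ^+ 2) != 0]].

Definition SNR (R : realType) (n q : nat) (a b : R) : R :=
  (a - b) ^+ 2 /
  (q%:R * (a * (1 - a / n%:R) + (q%:R - 1) * b * (1 - b / n%:R))).

(* Main.v *)
Require Import Defs.
From mathcomp Require mpoly.
Import -(notations) mpoly.
From mathcomp Require Import boolp classical_sets reals ereal exp.
From mathcomp Require Import all_boot all_order all_algebra.
From mathcomp Require Import ring lra zify.

Set Implicit Arguments.
Unset Strict Implicit.
Unset Printing Implicit Defensive.

Import Order.TTheory GRing.Theory Num.Theory.
Local Open Scope ring_scope.

(** Proof idea: duality.  If a random variable g, depending on the graph and on the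
    communities, satisfies E[f g] = E[f x] for every polynomial f of degree at most D,
    then by Cauchy-Schwarz the correlation is at most the ratio of the L2 norms of g
    and x ([corr_le_certificate]).  Since E[x^2] = (1 - 1/q)/q, it is enough to find
    such a g with E[g^2] <= 32 / (eta n).

    Let p_e be the conditional probability of the edge e, so that
    p_e = mu + lam x_e with x_e = 1{same community} - 1/q and lam = (a - b)/n, and
    p_e (1 - p_e) = v + kap x_e, where v is the mean edge variance.  Take
      g = sum_T u_T prod_(e in T) (Y_e - p_e),
    with scalars u_T.  Tested on the products of Y_e - mu over e in S, the requirement
    on g becomes a linear system, triangular for the inclusion of edge sets:
      sum_(T <= S) u_T E[prod_T (v + kap x_e) prod_(S minus T) lam x_e]
        = E[x prod_S lam x_e].

    The sparsity of the solution is what makes it small.  Call an edge set good when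
    it is built from the two marked vertices by successively attaching ears, that is
    paths joining two distinct vertices already reached through new vertices; its
    level is the number of ears.  Every S has a largest good subset M ([max_good]),
    and each connected piece of S minus M meets M and the marked vertices in at most
    one vertex; by the symmetry between communities, the contribution of S minus M is
    then a constant factor ([avg_saturated]).  So it suffices to solve the system on
    good sets, and to put u_T = 0 elsewhere ([certificate_exists]).

    To bound u_T, labels are viewed as elements of the group Z/q.  The function x_e
    is positive definite on the group of labelings, and is dominated in the
    positive definite order by the indicator 1{same community}.  Replacing one by the
    other at the zero labeling shows that integrating out m new vertices, all attached
    to old ones, yields at most q^-m, with no loss per vertex ([avg_ears_le]).  The
    recursion for u_S then gives a bound of order (lam / (q v))^|S| (q D)^(level - 1),
    up to constants, because a good set has few good subsets of each level
    ([sum_chain_weight]): removing one edge destroys at least one ear.  The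
    denominators E[prod_S (v + kap x_e)] are at least
    v^|S| min(1, delta/2)^(level - 1) ([weights_ge_ratio]).

    Finally, each edge of T contributes y = lam^2 / (q^2 v) = SNR/n to the norm of g,
    and an ear with m interior vertices can be attached in about n^m ways, so that
    attaching an ear costs a factor at most D^O(1) / (eta n) ([level_sum_step],
    [path_sum_le]).  Sets of level 1, which are the paths between the two marked
    vertices, contribute O(1 / (eta n)); every further ear contributes a factor
    D^O(1) q^2 / (delta eta n), which is at most 1/2 when q <= n^(1/2 - eps) and
    D <= n^(c eps) with c small.  A set of level at least 2 has at least two edges, so
    that for D <= 1 only the first term is present and no largeness of n is needed. *)

(** * Ears: edge sets built from two marked vertices *)

Section Ears.
Variables (n : nat) (r r' : 'I_n).
Implicit Types (u v w z : 'I_n) (p : seq 'I_n) (e : edge n).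
Implicit Types (S T U : {set edge n}).

Definition joins u v : {set edge n} :=
  [set e | (val e == (u, v)) || (val e == (v, u))].

Fixpoint walk_edges u p : {set edge n} :=
  if p is v :: p' then joins u v :|: walk_edges v p' else set0.

Definition ends e : {set 'I_n} := [set (val e).1; (val e).2].

(** The two roots count as touched by every edge set, so that the empty set can serve
    as the starting point of ear constructions. *)
Definition touched T : {set 'I_n} := [set r; r'] :|: \bigcup_(e in T) ends e.

(** The walk u, p, v is an open ear of T: its ends are distinct (by [uniq]) and
    touched by T, its interior is not. An ear may be a single edge outside T, whence
    the last condition. *)
Definition is_ear T u p v : bool :=
  [&& u \in touched T, v \in touched T, uniq (u :: rcons p v),
      all [predC touched T] p & [disjoint walk_edges u (rcons p v) & T]].

Inductive ears T : nat -> {set edge n} -> Prop :=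
| Ears0 : ears T 0 T
| EarsS k S u p v : ears T k S -> is_ear S u p v ->
    ears T k.+1 (S :|: walk_edges u (rcons p v)).

Lemma joinsC u v : joins u v = joins v u.
Proof. by apply/setP=> e; rewrite !inE orbC. Qed.

Lemma mem_joins_ends e : e \in joins (val e).1 (val e).2.
Proof. by rewrite inE -surjective_pairing eqxx. Qed.

Lemma joins_ends e u v : e \in joins u v -> ends e = [set u; v].
Proof.
by rewrite inE /ends => /orP[] /eqP -> //=; rewrite setUC.
Qed.

Lemma cards_joins u v : u != v -> #|joins u v| = 1%N.
Proof.
wlog lt_uv : u v / (u < v)%N => [H neq_uv|neq_uv].
  case: (ltngtP u v) => [uv|vu|/val_inj/eqP]; last by rewrite (negPf neq_uv).
    exact: H.
  by rewrite joinsC H // eq_sym.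
apply/eqP/cards1P; exists (exist _ (u, v) lt_uv : edge n).
apply/setP=> e; rewrite !inE -val_eqE /=.
case: eqP => //= _; apply/eqP => /= ev.
by have := valP e; rewrite /= ev /= ltnNge (ltnW lt_uv).
Qed.

Lemma touched0 : touched set0 = [set r; r'].
Proof. by rewrite /touched big_set0 setU0. Qed.

Lemma touchedU S T : touched (S :|: T) = touched S :|: touched T.
Proof.
by rewrite /touched bigcup_setU setUUr.
Qed.

Lemma touchedS S T : S \subset T -> touched S \subset touched T.
Proof. by move/setUidPr <-; rewrite touchedU subsetUl. Qed.

Lemma roots_touched T : [set r; r'] \subset touched T.
Proof. exact: subsetUl. Qed.

Lemma ends_touched T e : e \in T -> ends e \subset touched T.
Proof.
by move=> eT; rewrite subsetU // (bigcup_sup e) ?orbT.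
Qed.

Lemma walk_edges_ends u p e :
  e \in walk_edges u p -> ends e \subset [set:: u :: p].
Proof.
elim: p u => [|v p IH] u /=; first by rewrite inE.
rewrite in_setU => /orP[/joins_ends ->|/IH sub].
  by apply/subsetP => z; rewrite !inE => /orP[]->; rewrite ?orbT.
by apply: subset_trans sub _; apply/subsetP => z; rewrite !inE => ->; rewrite orbT.
Qed.

Lemma walk_edges_cat u p p' :
  walk_edges u (p ++ p') = walk_edges u p :|: walk_edges (last u p) p'.
Proof.
by elim: p u => [|v p IH] u /=; rewrite ?set0U // IH setUA.
Qed.

Lemma cards_walk_edges u p : uniq (u :: p) -> #|walk_edges u p| = size p.
Proof.
elim: p u => [|v p IH] u; first by rewrite cards0.
rewrite /= inE negb_or -andbA => /and3P[uv up vp].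
rewrite cardsU IH ?[uniq _]vp // cards_joins // (_ : _ :&: _ = set0) ?cards0 ?subn0 //.
apply/setP=> e; rewrite inE in_set0; apply/negP => /andP[/joins_ends eE /walk_edges_ends].
rewrite eE => /subsetP/(_ u); rewrite !inE eqxx => /(_ isT).
by rewrite (negPf uv) (negPf up).
Qed.

Lemma walk_vertex_touched u p z :
  uniq (u :: p) -> z \in p -> z \in touched (walk_edges u p).
Proof.
elim: p u => [|v p IH] u //=.
rewrite inE negb_or -andbA => /and3P[uv up vp].
rewrite touchedU in_setU inE => /orP[/eqP ->|zp]; last first.
  by rewrite IH ?orbT.
have /cards1P[e je] : #|joins u v| == 1%N by rewrite cards_joins.
have ej : e \in joins u v by rewrite je inE.
apply/orP; left; apply: (subsetP (ends_touched ej)).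
by rewrite (joins_ends ej) !inE eqxx orbT.
Qed.

Lemma touched_ear S u p v : is_ear S u p v ->
  touched (S :|: walk_edges u (rcons p v)) = touched S :|: [set:: p].
Proof.
case/and5P => uS vS up pS _.
rewrite touchedU; apply/setP => z; rewrite 2!in_setU.
case zS: (z \in touched S) => //=.
apply/idP/idP.
  rewrite {1}/touched in_setU => /orP[zr|].
    by move: zS; rewrite (subsetP (roots_touched S)).
  move/bigcupP => [e /walk_edges_ends/subsetP sub /sub].
  rewrite !inE mem_rcons inE => /or3P[/eqP zu|/eqP zv|//].
    by move: uS; rewrite -zu zS.
  by move: vS; rewrite -zv zS.
rewrite inE => zp; apply: walk_vertex_touched => //.
by rewrite mem_rcons inE zp orbT.
Qed.

Lemma cards_touched_ear S u p v : is_ear S u p v ->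
  #|touched (S :|: walk_edges u (rcons p v))| = (#|touched S| + size p)%N.
Proof.
move=> ear; rewrite (touched_ear ear) cardsU.
case/and5P: ear => _ _ /= /andP[_ up] /allP pS _.
rewrite (_ : _ :&: _ = set0) ?cards0 ?subn0.
  congr (_ + _)%N; rewrite cardsE; apply/card_uniqP.
  by move: up; rewrite rcons_uniq => /andP[].
apply/setP=> z; rewrite in_set0; apply/negP=> /setIP[zS]; rewrite inE => zp.
by have := pS z zp; rewrite /= zS.
Qed.

Lemma cards_ear S u p v : is_ear S u p v ->
  #|S :|: walk_edges u (rcons p v)| = (#|S| + (size p).+1)%N.
Proof.
case/and5P => _ _ up _ dS.
rewrite cardsU cards_walk_edges // size_rcons.
by move: dS; rewrite disjoint_sym -setI_eq0 => /eqP ->; rewrite cards0 subn0.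
Qed.

Lemma ears_sub T k S : ears T k S -> T \subset S.
Proof.
by elim=> // k' S' u p v _ sub _; rewrite subsetU // sub.
Qed.

(** An ear brings one more edge than it brings new vertices, so the number of ears is
    determined by cardinalities. *)
Lemma ears_card T k S : ears T k S ->
  (#|S| + #|touched T| = #|T| + #|touched S| + k)%N.
Proof.
elim=> [|k' S' u p v _ IH ear]; first by rewrite addn0.
rewrite (cards_ear ear) (cards_touched_ear ear).
by rewrite addnAC IH !addnS addnA [in RHS]addnAC.
Qed.

Lemma ears_trans T j U i S : ears T j U -> ears U i S -> ears T (i + j) S.
Proof.
move=> TU; elim=> [//|k S' u p v _ IH ear]; exact: EarsS IH ear.
Qed.

Lemma ears_step T u p v : is_ear T u p v ->
  ears T 1 (T :|: walk_edges u (rcons p v)).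
Proof. exact/EarsS/Ears0. Qed.

(** Each edge of a walk with at least one interior vertex has an end in the interior;
    hence the walk avoids T as soon as its interior does. *)
Lemma walk_edges_inner u p w e : e \in walk_edges u (rcons p w) ->
  p != [::] -> exists2 z, z \in p & z \in ends e.
Proof.
elim: p u => [|v p IH] u //= ; rewrite in_setU => /orP[/joins_ends eE _|ep _].
  by exists v; rewrite ?eE !inE eqxx ?orbT.
case: p ep IH => [|v' p] ep IH.
  move: ep; rewrite /= setU0 => /joins_ends eE.
  by exists v; rewrite ?eE !inE eqxx.
have [z zp ze] := IH v ep isT.
by exists z; rewrite // inE zp orbT.
Qed.

(** Follow the walk until it first leaves T, then until it first comes back to a
    touched vertex: this piece is an ear of T. *)
Lemma ear_in_walk T u p : uniq (u :: p) ->
  u \in touched T -> last u p \in touched T -> ~~ (walk_edges u p \subset T) ->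
  exists u' p' v', is_ear T u' p' v'
    /\ walk_edges u' (rcons p' v') \subset walk_edges u p.
Proof.
elim: p u => [|v p IH] u up uT lT; first by rewrite sub0set.
have uv : u != v by move: up => /= /andP[]; rewrite inE negb_or => /andP[].
have /cards1P[e je] : #|joins u v| == 1%N by rewrite cards_joins.
have ej : e \in joins u v by rewrite je inE.
case eT : (e \in T).
  rewrite /= je subUset sub1set eT /= => npT.
  have vT : v \in touched T.
    by apply: (subsetP (ends_touched eT)); rewrite (joins_ends ej) !inE eqxx orbT.
  move: up; rewrite /= => /andP[_ vp].
  have [u' [p' [v' [ear sub]]]] := IH v vp vT lT npT.
  exists u', p', v'; split=> //.
  by apply: subset_trans sub (subsetUr _ _).
move=> _.
have hT : has (mem (touched T)) (v :: p).
  by apply/hasP; exists (last v p) => //; apply: mem_last.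
have [w [p1 [p2 [def_p wT p1T]]]] : exists w p1 p2,
    [/\ v :: p = rcons p1 w ++ p2, w \in touched T & ~~ has (mem (touched T)) p1].
  by case/split_find: hT => w p1 p2 wT p1T; exists w, p1, p2.
exists u, p1, w; split; last by rewrite def_p walk_edges_cat subsetUl.
have up' : uniq (u :: rcons p1 w).
  by move: up; rewrite def_p -cat_cons cat_uniq => /andP[].
apply/and5P; split=> //; first by rewrite -all_predC in p1T.
apply/pred0P => e' /=; apply/negP => /andP[e'p e'T].
have [p10|p1N0] := eqVneq p1 [::].
  move: def_p e'p; rewrite p10 /= setU0 => -[vw _]; rewrite -vw je inE => /eqP ee.
  by move: eT; rewrite -ee e'T.
have [z zp1 ze] := walk_edges_inner e'p p1N0.
move/hasP: p1T; apply; exists z => //=.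
exact: (subsetP (ends_touched e'T)).
Qed.

(** A set admitting no ear inside U swallows, one ear after the other, every subset of
    U built from the roots by ears. *)
Lemma ears_absorb S k T U : ears set0 k S -> S \subset U ->
  (forall u p v, is_ear T u p v -> ~~ (walk_edges u (rcons p v) \subset U)) ->
  S \subset T.
Proof.
move=> + + noear; elim=> [|{}k {}S u p v _ IH ear]; first by rewrite !sub0set.
rewrite subUset => /andP[SU pU]; have ST := IH SU.
rewrite subUset ST /=; apply/negPn/negP => npT.
have sub := subsetP (touchedS ST); case/and5P: ear => uS vS up _ _.
have vT : last u (rcons p v) \in touched T by rewrite last_rcons sub.
have [u' [p' [v' [ear' sub']]]] := ear_in_walk up (sub _ uS) vT npT.
by have := noear _ _ _ ear'; rewrite (subset_trans sub' pU).
Qed.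

Lemma ears_saturate S T : T \subset S -> exists k M,
  [/\ ears T k M, M \subset S &
   forall u p v, is_ear M u p v -> ~~ (walk_edges u (rcons p v) \subset S)].
Proof.
have [m] := ubnP #|S :\: T|; elim: m T => // m IH T ltm TS.
case: (EM (exists u p v, is_ear T u p v /\ walk_edges u (rcons p v) \subset S)); last first.
  move=> noear; exists 0, T; split=> //; first exact: Ears0.
  by move=> u p v ear; apply/negP => sub; apply: noear; exists u, p, v.
move=> [u [p [v [ear sub]]]].
have US : T :|: walk_edges u (rcons p v) \subset S by rewrite subUset TS.
have TP : T \proper T :|: walk_edges u (rcons p v).
  by rewrite properEcard subsetUl (cards_ear ear) -[X in (X < _)%N]addn0 ltn_add2l.
have ltU : (#|S :\: (T :|: walk_edges u (rcons p v))| < m)%N.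
  apply: (@leq_trans #|S :\: T|) ltm; rewrite !cardsDS //; apply: ltn_sub2l; last exact: proper_card.
  exact: leq_trans (proper_card TP) (subset_leq_card US).
have [k [M [TM MS noear]]] := IH _ ltU US.
exists (k + 1)%N, M; split=> //.
exact: ears_trans (ears_step ear) TM.
Qed.

Lemma ears_between S k T : ears set0 k S -> T \subset S -> exists j, ears T j S.
Proof.
move=> gS TS; have [j [M [TM MS noear]]] := ears_saturate TS.
exists j; suff -> : S = M by [].
apply/eqP; rewrite eqEsubset MS andbT.
exact: ears_absorb gS (subxx _) noear.
Qed.

(** New vertices are attached to old ones through new edges only: a function constant
    along the edges of S outside T spreads its value from T to all of S. *)
Lemma ears_constant (A : eqType) (c : A) T k S (rho : 'I_n -> A) :
  ears T k S ->
  (forall e, e \in S :\: T -> rho (val e).1 = rho (val e).2) ->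
  (forall z, z \in touched T -> rho z = c) ->
  forall z, z \in touched S -> rho z = c.
Proof.
move=> + + rT; elim=> [//|{}k {}S u p v TS IH ear] rc.
have rS z : z \in touched S -> rho z = c.
  apply: IH => e /setDP[eS eT]; apply: rc; rewrite in_setD eT in_setU eS //.
move=> z; rewrite (touched_ear ear) in_setU => /orP[/rS //|]; rewrite inE => zp.
case/and5P: ear => /rS ru _ up _ dS.
have rw e : e \in walk_edges u (rcons p v) -> rho (val e).1 = rho (val e).2.
  move=> ep; apply: rc; rewrite in_setD in_setU ep orbT andbT.
  apply/negP => eT; have eS := subsetP (ears_sub TS) _ eT.
  by move/pred0P: dS => /(_ e) /=; rewrite ep eS.
have {}zp : z \in rcons p v by rewrite mem_rcons inE zp orbT.
move: {dS rc IH} ru up rw zp; move: {p v}(rcons p v) u.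
elim=> [//|w p' IH] u ru; rewrite /= inE negb_or -andbA => /and3P[uw _ up] rw.
have rwc : rho w = c.
  have /cards1P[e je] : #|joins u w| == 1%N by rewrite cards_joins.
  have ej : e \in joins u w by rewrite je inE.
  have := rw e; rewrite in_setU ej => /(_ isT).
  by move: ej; rewrite inE -ru => /orP[]/eqP -> /=.
rewrite inE => /orP[/eqP -> //|]; apply: IH up _ => // e ep.
by apply: rw; rewrite in_setU ep orbT.
Qed.

(** When M has no ear inside S, two distinct vertices touched by M are never joined by
    a path in S minus M, since a shortest such path would contain an ear. Hence any
    values prescribed on the vertices of M can be propagated along the edges of S
    minus M without conflict. *)
Lemma saturated_extension (A : Type) (c : A) M S (rho : 'I_n -> A) :
  (forall u p v, is_ear M u p v -> ~~ (walk_edges u (rcons p v) \subset S)) ->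
  exists rho' : 'I_n -> A,
    (forall z, z \in touched M -> rho' z = rho z) /\
    (forall e, e \in S :\: M -> rho' (val e).1 = rho' (val e).2).
Proof.
move=> noear.
pose adj := [rel y z | [exists e in S :\: M, e \in joins y z]].
have adjC : symmetric adj.
  by move=> y z; rewrite /=; apply: eq_existsb => e; rewrite joinsC.
have sep b b' : b \in touched M -> b' \in touched M -> connect adj b b' -> b = b'.
  move=> bM b'M /connectP[p0 p0P b'E]; apply/eqP/negPn/negP => bb'.
  case: (shortenP p0P) b'E => p pP up _ b'E.
  have sub : walk_edges b p \subset S :\: M.
    elim: p b pP {bM bb' b'E p0P} up => [|w p IH] b /=; first by rewrite sub0set.
    case/andP => /exists_inP[e eSM ej] pP; rewrite inE negb_or -andbA => /and3P[bw wp up].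
    rewrite subUset IH ?andbT ?wp //.
    have /cards1P[e' je] : #|joins b w| == 1%N by rewrite cards_joins.
    by move: ej; rewrite je inE => /eqP ee; rewrite sub1set -ee.
  have pN0 : p != [::] by apply: contraNneq bb' => pE; rewrite b'E pE.
  have npM : ~~ (walk_edges b p \subset M).
    apply/negP => pM; suff w0 : walk_edges b p == set0.
      by move: w0; rewrite -cards_eq0 cards_walk_edges // size_eq0 (negPf pN0).
    rewrite -subset0 -(setICr M) subsetI pM /=.
    by apply: subset_trans sub _; rewrite setDE subsetIr.
  have b'T : last b p \in touched M by rewrite -b'E.
  have [u [q [v [ear sub']]]] := ear_in_walk up bM b'T npM.
  have := noear _ _ _ ear; rewrite (subset_trans sub') //.
  by apply: subset_trans sub _; rewrite subsetDl.
(* Each vertex takes the value of the unique touched vertex of its component in S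
   minus M, or the default c when there is none. *)
exists (fun z => if [pick b in touched M | connect adj b z] is Some b then rho b else c).
split=> [z zM|e eSM].
  case: pickP => [b /andP[bM bz]|/(_ z)]; first by rewrite (sep _ _ bM zM bz).
  by rewrite /= zM connect0.
have e12 : adj (val e).1 (val e).2.
  by apply/exists_inP; exists e => //; apply: mem_joins_ends.
suff E b : connect adj b (val e).1 = connect adj b (val e).2.
  by under eq_pick => b do rewrite E.
apply/idP/idP => H; apply: connect_trans H (connect1 _) => //.
by rewrite adjC.
Qed.
End Ears.

(** * Positive definite functions on the group of labelings *)

Section Gram.
Variables (R : realType) (n q : nat).
Local Notation Lab := {ffun 'I_n -> 'I_q.+1}.
Implicit Types (F G : Lab -> R) (s t : Lab) (N B : {set 'I_n}) (A H : {set edge n}).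

(** Labels are the elements of the additive group 'I_q.+1, that is Z/(q+1), and
    labelings form the product group. Positive definiteness is stated through a finite
    Gram representation of the kernel F (s - t), which gives the closure under
    products by tensoring and avoids complex characters. *)
Definition positive_definite F : Prop :=
  exists (I : finType) (phi : I -> Lab -> R),
    forall s t, F (s - t) = \sum_i phi i s * phi i t.

Lemma pd_ext F G : F =1 G -> positive_definite F -> positive_definite G.
Proof. by move=> FG [I [phi H]]; exists I, phi => s t; rewrite -FG H. Qed.

Lemma pd_cst c : 0 <= c -> positive_definite (fun=> c).
Proof.
move=> c0; exists 'I_1, (fun _ _ => Num.sqrt c) => _ _.
by rewrite big_ord1 -expr2 sqr_sqrtr.
Qed.

Lemma pd_add F G : positive_definite F -> positive_definite G ->
  positive_definite (fun s => F s + G s).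
Proof.
move=> [I [phi HF]] [J [psi HG]].
exists (I + J)%type, (fun k => match k with inl i => phi i | inr j => psi j end).
by move=> s t; rewrite HF HG big_sumType.
Qed.

Lemma pd_mul F G : positive_definite F -> positive_definite G ->
  positive_definite (fun s => F s * G s).
Proof.
move=> [I [phi HF]] [J [psi HG]].
exists (I * J)%type, (fun k s => phi k.1 s * psi k.2 s).
move=> s t; rewrite HF HG mulr_suml.
under eq_bigr => i _ do rewrite mulr_sumr.
by rewrite pair_bigA; apply: eq_bigr => -[i j] _ /=; rewrite mulrACA.
Qed.

Lemma pd_ge0 F : positive_definite F -> 0 <= F 0.
Proof.
move=> [I [phi HF]]; rewrite -[X in F X](subrr 0) HF; apply: sumr_ge0 => i _.
by rewrite -expr2 sqr_ge0.
Qed.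

(** Cauchy-Schwarz for the Gram vectors of s and of 0. *)
Lemma pd_le F s : positive_definite F -> `|F s| <= F 0.
Proof.
move=> [I [phi HF]].
have E0 t : F 0 = \sum_i phi i t ^+ 2 by rewrite -(subrr t) HF; under [RHS]eq_bigr => i _ do rewrite expr2.
have Es : F s = \sum_i phi i s * phi i 0 by rewrite -[in LHS](subr0 s) HF.
rewrite Es; apply: (le_trans (ler_norm_sum _ _ _)).
have -> : F 0 = \sum_i (phi i s ^+ 2 + phi i 0 ^+ 2) / 2.
  by rewrite -mulr_suml big_split /= -(E0 s) -(E0 0); lra.
apply: ler_sum => i _; move: (phi i s) (phi i 0) => x y.
have := sqr_ge0 (x + y); have := sqr_ge0 (x - y).
by rewrite ler_norml; move=> ? ?; apply/andP; split; nra.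
Qed.

(** Products preserve the positive definite order between positive definite functions:
    telescope G G' - F F' = G (G' - F') + (G - F) F'. *)
Lemma pd_prod_le (P : seq (edge n)) (F G : edge n -> Lab -> R) :
  (forall e, positive_definite (F e)) ->
  (forall e, positive_definite (fun s => G e s - F e s)) ->
  positive_definite (fun s => \prod_(e <- P) F e s) /\
  positive_definite (fun s => \prod_(e <- P) G e s - \prod_(e <- P) F e s).
Proof.
move=> pF pGF; elim: P => [|e P [IHF IHG]].
  split; first by apply: (@pd_ext (fun=> 1)) => [s|]; rewrite ?big_nil //; apply: pd_cst.
  apply: (@pd_ext (fun=> 0)) => [s|]; last exact: pd_cst.
  by rewrite !big_nil subrr.
split.
  by apply: pd_ext (pd_mul (pF e) IHF) => s; rewrite big_cons.
have pG : positive_definite (G e).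
  by apply: pd_ext (pd_add (pF e) (pGF e)) => s; rewrite addrC subrK.
apply: pd_ext (pd_add (pd_mul pG IHG) (pd_mul (pGF e) IHF)) => s.
by rewrite !big_cons; ring.
Qed.

(** The subgroup of labelings supported on N. Summing over its translates integrates
    out the labels of the vertices of N. *)
Definition shifts N : {set Lab} := [set s : Lab | [forall z, (z \notin N) ==> (s z == 0)]].

Lemma shiftsP N s : reflect (forall z, z \notin N -> s z = 0) (s \in shifts N).
Proof.
rewrite inE; apply: (iffP forallP) => H z; first by move/(implyP (H z))/eqP.
by apply/implyP => /H ->.
Qed.

Lemma shifts_add N s t : s \in shifts N -> (s + t \in shifts N) = (t \in shifts N).
Proof.
move/shiftsP => sN; apply/shiftsP/shiftsP => tN z zN.
  by have := tN z zN; rewrite ffunE sN // add0r.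
by rewrite ffunE sN // tN // addr0.
Qed.

Lemma shifts0 N : 0 \in shifts N.
Proof. by apply/shiftsP => z _; rewrite ffunE. Qed.

Lemma shiftsN N s : s \in shifts N -> - s \in shifts N.
Proof. by move/shiftsP => sN; apply/shiftsP => z zN; rewrite ffunE sN // oppr0. Qed.

Lemma card_shifts N : #|shifts N| = (q.+1 ^ #|N|)%N.
Proof.
transitivity (#|'I_q.+1| ^ #|N|)%N; last by rewrite card_ord.
rewrite -(card_pffun_on (0 : 'I_q.+1)); apply: eq_card => s.
apply/shiftsP/pffun_onP => [sN|[sN _] z zN].
  split=> // ; apply/subsetP => z; rewrite inE => sz.
  by apply: contraNT sz => /sN ->.
by apply/eqP/negPn/negP => sz; move/negP: zN; apply; apply: (subsetP sN); rewrite inE.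
Qed.

Lemma sum_shift N s (G : Lab -> R) : s \in shifts N ->
  \sum_(t in shifts N) G (s + t) = \sum_(t in shifts N) G t.
Proof.
move=> sN; rewrite [RHS](reindex_inj (addrI s)) /=.
by apply: eq_bigl => t; rewrite shifts_add.
Qed.

(** The subgroup is closed under subtraction, so the sum over t of F (s - t' + t) can
    be symmetrised into a double sum over t and t', which is a Gram kernel for the
    summed vectors. *)
Lemma pd_sum_shifts N F : positive_definite F ->
  positive_definite (fun s => \sum_(t in shifts N) F (s + t)).
Proof.
move=> [I [phi HF]]; pose c : R := #|shifts N|%:R.
have c0 : 0 < c by rewrite ltr0n; apply/card_gt0P; exists 0; exact: shifts0.
exists I, (fun i s => (Num.sqrt c)^-1 * \sum_(t in shifts N) phi i (s + t)) => s t.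
have E : c * \sum_(r in shifts N) F (s - t + r) =
    \sum_i (\sum_(r in shifts N) phi i (s + r)) * (\sum_(r in shifts N) phi i (t + r)).
  rewrite /c -sum1_card natr_sum mulr_suml.
  under [RHS]eq_bigr => i _ do rewrite mulr_suml.
  rewrite [RHS]exchange_big /=.
  rewrite (eq_bigr (fun r => \sum_(r' in shifts N) F (s + r' - (t + r)))); last first.
    move=> r rN; rewrite mul1r -(@sum_shift N (- r) (fun r' => F (s - t + r'))) ?shiftsN //.
    by apply: eq_bigr => r' _; congr F; rewrite opprD [RHS]addrACA [- r + r']addrC.
  rewrite exchange_big; apply: eq_bigr => r _ /=.
  under eq_bigr => r' _ do rewrite HF.
  rewrite exchange_big; apply: eq_bigr => i _ /=.
  by rewrite mulr_sumr.
apply: (mulfI (lt0r_neq0 c0)); rewrite E mulr_sumr; apply: eq_bigr => i _.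
by rewrite mulrACA -expr2 exprVn sqr_sqrtr ?(ltW c0) // mulVKf ?gt_eqF.
Qed.

Definition avg F : R := (q.+1%:R ^+ n)^-1 * \sum_(s : Lab) F s.

Definition local_on B F : Prop := forall s t, {in B, s =1 t} -> F s = F t.

Lemma avg_ext F G : F =1 G -> avg F = avg G.
Proof. by move=> FG; congr (_ * _); apply: eq_bigr. Qed.

Lemma avg_shift t F : avg (fun s => F (s + t)) = avg F.
Proof. by congr (_ * _); rewrite [RHS](reindex_inj (addIr t)). Qed.

Lemma avg_sum (I : finType) (P : pred I) (F : I -> Lab -> R) :
  avg (fun s => \sum_(i | P i) F i s) = \sum_(i | P i) avg (F i).
Proof. by rewrite /avg exchange_big mulr_sumr. Qed.

Lemma avgZ c F : avg (fun s => c * F s) = c * avg F.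
Proof. by rewrite /avg -mulr_sumr mulrCA. Qed.

Lemma avgD F G : avg (fun s => F s + G s) = avg F + avg G.
Proof. by rewrite /avg big_split mulrDr. Qed.

Lemma avg_le F G : (forall s, F s <= G s) -> avg F <= avg G.
Proof.
move=> FG; apply: ler_wpM2l; first by rewrite invr_ge0 exprn_ge0 // ler0n.
exact: ler_sum.
Qed.

Lemma avg_cst c : avg (fun=> c) = c.
Proof.
rewrite /avg sumr_const card_ffun !card_ord -[c *+ _]mulr_natr natrX mulrC mulfK //.
Qed.

Lemma avg_ge0 F : (forall s, 0 <= F s) -> 0 <= avg F.
Proof. by move=> F0; rewrite -(avg_cst 0); apply: avg_le. Qed.

Lemma avg_norm F : `|avg F| <= avg (fun s => `|F s|).
Proof.
rewrite /avg normrM ger0_norm ?invr_ge0 ?exprn_ge0 ?ler0n //.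
apply: ler_wpM2l; first by rewrite invr_ge0 exprn_ge0 // ler0n.
exact: ler_norm_sum.
Qed.

Lemma avg_shifts N F :
  avg F = (q.+1%:R ^+ #|N|)^-1 * avg (fun s => \sum_(t in shifts N) F (s + t)).
Proof.
rewrite avg_sum; under eq_bigr => t _ do rewrite avg_shift.
rewrite sumr_const card_shifts -[avg F *+ _]mulr_natl natrX mulKf //.
Qed.

Lemma shifts_setT s : s \in shifts [set: 'I_n].
Proof. by apply/shiftsP => z; rewrite inE. Qed.

Lemma pd_avg_ge0 F : positive_definite F -> 0 <= avg F.
Proof.
move=> pF; have := pd_ge0 (pd_sum_shifts [set: 'I_n] pF).
under eq_bigr => t _ do rewrite add0r.
rewrite (eq_bigl predT) => [F0|t]; last by rewrite shifts_setT.
by rewrite mulr_ge0 // invr_ge0 exprn_ge0 // ler0n.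
Qed.

Lemma local_add N F s t : local_on (~: N) F -> t \in shifts N -> F (s + t) = F s.
Proof.
move=> lF /shiftsP tN; apply: lF => z; rewrite inE => zN.
by rewrite ffunE tN // addr0.
Qed.

Lemma local_sub B B' F : B \subset B' -> local_on B F -> local_on B' F.
Proof. by move=> /subsetP sub lF s t st; apply: lF => z /sub /st. Qed.

Lemma local_mul B F G : local_on B F -> local_on B G -> local_on B (fun s => F s * G s).
Proof. by move=> lF lG s t st; rewrite (lF s t) // (lG s t). Qed.

(** If F ignores the labels on N, those labels can be averaged inside the other
    factor. *)
Lemma avg_local_mul N F G : local_on (~: N) F ->
  avg (fun s => F s * G s) =
  (q.+1%:R ^+ #|N|)^-1 * avg (fun s => F s * \sum_(t in shifts N) G (s + t)).
Proof.
move=> lF; rewrite (avg_shifts N); congr (_ * _); apply: avg_ext => s.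
by rewrite mulr_sumr; apply: eq_bigr => t tN; rewrite (local_add _ lF).
Qed.

End Gram.

(** * Averages of the centered agreement indicators *)

Section Kernel.
Variables (R : realType) (n q : nat).
Local Notation Lab := {ffun 'I_n -> 'I_q.+1}.
Implicit Types (F G : Lab -> R) (s t : Lab) (N B : {set 'I_n}) (A H S T M : {set edge n}).
Implicit Types (u v w z : 'I_n) (p : seq 'I_n) (e : edge n).

Definition agree u w s : R := (s u == s w)%:R.
(** The number of communities is q.+1, so this has mean zero for two distinct
    vertices. *)
Definition cagree u w s : R := agree u w s - q.+1%:R^-1.
Definition eagree e s : R := cagree (val e).1 (val e).2 s.

Lemma qpos : 0 < q.+1%:R :> R.
Proof. by rewrite ltr0n. Qed.

Lemma invq_ge0 : 0 <= q.+1%:R^-1 :> R.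
Proof. by rewrite invr_ge0 ler0n. Qed.

Lemma agreeC u w s : agree u w s = agree w u s.
Proof. by rewrite /agree eq_sym. Qed.

Lemma cagreeC u w s : cagree u w s = cagree w u s.
Proof. by rewrite /cagree agreeC. Qed.

Lemma eagree_joins e u w s : e \in joins u w -> eagree e s = cagree u w s.
Proof.
by rewrite inE /eagree => /orP[]/eqP -> //=; rewrite cagreeC.
Qed.

Lemma sum_indicator (c : 'I_q.+1) : \sum_(d : 'I_q.+1) (d == c)%:R = 1 :> R.
Proof.
by rewrite (bigD1 c) //= eqxx big1 ?addr0 // => d /negPf ->.
Qed.

(** The indicator that s - t agrees at u and w compares the differences s u - s w and
    t u - t w; projecting away constants in the 'I_q.+1 coordinates subtracts exactly
    1/(q+1). *)
Lemma pd_cagree u w : positive_definite (@cagree u w).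
Proof.
exists 'I_q.+1, (fun c s => (c == s u - s w)%:R - q.+1%:R^-1) => s t.
have E : \sum_(c : 'I_q.+1) (c == s u - s w)%:R * (c == t u - t w)%:R
    = ((s - t) u == (s - t) w)%:R :> R.
  rewrite (bigD1 (s u - s w)) //= eqxx mul1r big1 ?addr0 => [|c /negPf ->]; last by rewrite mul0r.
  rewrite !ffunE; congr (nat_of_bool _)%:R.
  rewrite -[LHS]subr_eq0 -[RHS]subr_eq0 !opprB addrACA [in RHS]addrACA.
  by rewrite [- s w + _]addrC.
under eq_bigr => c _ do rewrite mulrBl !mulrBr.
rewrite /cagree /agree !sumrB E -mulr_suml -mulr_sumr !sum_indicator sumr_const card_ord.
rewrite -[_ / _ *+ q.+1]mulr_natl; have := qpos; move: (q.+1%:R : R) ((_ == _)%:R : R) => k x k0.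
by have kN0 := lt0r_neq0 k0; field.
Qed.

Lemma pd_eagree e : positive_definite (eagree e).
Proof. exact: pd_cagree. Qed.

Lemma pd_prod_eagree H : positive_definite (fun s => \prod_(e in H) eagree e s).
Proof.
have [+ _] := @pd_prod_le R n q (enum H) eagree eagree pd_eagree
  (fun e => pd_ext (fun s => esym (subrr (eagree e s))) (pd_cst n q (lexx (0 : R)))).
by apply: pd_ext => s; rewrite big_enum.
Qed.

(** By positive definiteness the sum is largest at s = 0, where it only increases when
    each [eagree] is replaced by the agreement indicator; there the sum counts the
    shifts constant along all edges of H, and the rigidity hypothesis leaves only the
    zero shift. Bounding the factors by their absolute values instead would lose a
    constant factor for each vertex. *)
Lemma sum_shifts_eagree N H s :
  (forall t, t \in shifts q N -> (forall e, e \in H -> t (val e).1 = t (val e).2) -> t = 0) ->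
  `|\sum_(t in shifts q N) \prod_(e in H) eagree e (s + t)| <= 1.
Proof.
move=> rigid.
apply: le_trans (pd_le s (pd_sum_shifts N (pd_prod_eagree H))) _.
have [_ pd1] := @pd_prod_le R n q (enum H) eagree (fun e => agree (val e).1 (val e).2) pd_eagree
  (fun e => pd_ext (fun s => esym (subKr _ _)) (pd_cst n q invq_ge0)).
have := pd_ge0 (pd_sum_shifts N pd1); rewrite sumrB subr_ge0 => le1.
under eq_bigr => t _ do rewrite -big_enum.
apply: le_trans le1 _.
rewrite (bigD1 (0 : Lab)) ?shifts0 //= addr0 big1 ?big1_eq; last first.
  by move=> e _; rewrite /agree !ffunE eqxx.
rewrite big1 ?addr0 // => t /andP[tN tN0].
rewrite add0r big_enum /=.
have [e eH te] : exists2 e, e \in H & t (val e).1 != t (val e).2.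
  apply/exists_inP; rewrite -[X in is_true X]negbK; apply/negP.
  rewrite negb_exists_in => /forall_inP ct; move/eqP: tN0; apply; apply: rigid => // e /ct.
  by rewrite negbK => /eqP.
by rewrite (bigD1 e) //= /agree (negPf te) mul0r.
Qed.

Lemma avg_eagree_le N H F : local_on (~: N) F ->
  (forall t, t \in shifts q N -> (forall e, e \in H -> t (val e).1 = t (val e).2) -> t = 0) ->
  `|avg (fun s => F s * \prod_(e in H) eagree e s)|
    <= (q.+1%:R ^+ #|N|)^-1 * avg (fun s => `|F s|).
Proof.
move=> lF rigid; rewrite (avg_local_mul _ lF) normrM.
have k0 : 0 <= (q.+1%:R ^+ #|N|)^-1 :> R by rewrite invr_ge0 exprn_ge0 // ler0n.
rewrite ger0_norm //; apply: ler_wpM2l => //.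
apply: le_trans (avg_norm _) _; apply: avg_le => s.
by rewrite normrM ler_piMr // sum_shifts_eagree.
Qed.

Variables r r' : 'I_n.
Local Notation touched := (touched r r').
Local Notation ears := (ears r r').
Local Notation is_ear := (is_ear r r').

(** Each new vertex gains a full factor 1/(q+1), whatever the way the ears from T to S
    are attached to each other. *)
Lemma avg_ears_le T k S F : ears T k S -> local_on (touched T) F ->
  `|avg (fun s => F s * \prod_(e in S :\: T) eagree e s)|
    <= (q.+1%:R ^+ (#|touched S| - #|touched T|))^-1 * avg (fun s => `|F s|).
Proof.
move=> TS lF; have sub := touchedS r r' (ears_sub TS).
rewrite -cardsDS //; apply: avg_eagree_le.
  apply: local_sub lF; apply/subsetP => z zT; rewrite in_setC in_setD negb_and zT //.
move=> t /shiftsP tN tc; apply/ffunP => z; rewrite ffunE.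
have [zS|zS] := boolP (z \in touched S); last by apply: tN; rewrite in_setD negb_and zS orbT.
apply: (ears_constant TS tc _ zS) => {zS}z zT; apply: tN.
by rewrite in_setD negb_and zT.
Qed.

(** Translating the labeling by a function that is constant along the edges of S minus
    M leaves the product unchanged, and such translations act arbitrarily on the
    labels of M; so after integrating out the other labels the product no longer
    depends on the labels of M. *)
Lemma avg_saturated M S :
  (forall u p v, is_ear M u p v -> ~~ (walk_edges u (rcons p v) \subset S)) ->
  exists c : R, forall F, local_on (touched M) F ->
    avg (fun s => F s * \prod_(e in S :\: M) eagree e s) = c * avg F.
Proof.
move=> noear; pose N := ~: touched M.
pose X s : R := \prod_(e in S :\: M) eagree e s.
pose c : R := (q.+1%:R ^+ #|N|)^-1 * \sum_(t in shifts q N) X t.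
exists c => F lF; rewrite (@avg_local_mul _ _ _ N) ?setCK // /c -mulrA; congr (_ * _).
rewrite -avgZ; apply: avg_ext => s; rewrite mulrC; congr (_ * _).
have [rho [rhoM rhoc]] := saturated_extension (0 : 'I_q.+1) (fun z => s z) noear.
pose t0 : Lab := [ffun z => rho z].
have tN : s - t0 \in shifts q N.
  by apply/shiftsP => z; rewrite in_setC negbK => zM; rewrite !ffunE rhoM // subrr.
rewrite -[RHS](sum_shift _ tN); apply: eq_bigr => t _; apply: eq_bigr => e eSM.
rewrite /eagree /cagree /agree !ffunE (rhoc e eSM); congr ((nat_of_bool _)%:R - _).
by rewrite ![_ - rho _ + _]addrAC (inj_eq (addIr _)).
Qed.

(** Averaging over the label of z alone already gives zero. *)
Lemma avg_cagree0 u z F : u != z -> local_on (~: [set z]) F ->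
  avg (fun s => F s * cagree u z s) = 0.
Proof.
move=> uz lF; pose d (c : 'I_q.+1) : Lab := [ffun x => if x == z then c else 0].
have dz c s : F (s + d c) = F s.
  by apply: lF => x; rewrite in_setC in_set1 => /negPf xz; rewrite !ffunE xz addr0.
apply: (mulfI (lt0r_neq0 qpos)); rewrite mulr0.
transitivity (\sum_(c : 'I_q.+1) avg (fun s => F (s + d c) * cagree u z (s + d c))).
  under eq_bigr => c _ do rewrite (avg_shift (d c) (fun s => F s * cagree u z s)).
  by rewrite sumr_const card_ord mulr_natl.
rewrite -avg_sum -[RHS](avg_cst n q); apply: avg_ext => s.
under eq_bigr => c _ do rewrite dz.
rewrite -mulr_sumr sumrB sumr_const card_ord -[_ *+ q.+1]mulr_natl mulfV ?(lt0r_neq0 qpos) //.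
rewrite (eq_bigr (fun c => (c == s u - s z)%:R)); first by rewrite sum_indicator subrr mulr0.
move=> c _; rewrite /agree !ffunE (negPf uz) eqxx addr0; congr (nat_of_bool _)%:R.
by rewrite [RHS]eq_sym subr_eq addrC.
Qed.

Lemma avg_agree u z : u != z -> avg (agree u z) = q.+1%:R^-1.
Proof.
move=> uz; have := @avg_cagree0 u z (fun=> 1) uz (fun _ _ _ => erefl).
rewrite (avg_ext (G := fun s => agree u z s + - q.+1%:R^-1)) => [|s]; last by rewrite mul1r.
by rewrite avgD avg_cst => /eqP; rewrite subr_eq0 => /eqP.
Qed.

Lemma avg_norm_cagree u z : u != z -> avg (fun s => `|cagree u z s|) <= 2 / q.+1%:R.
Proof.
move=> uz; apply: (@le_trans _ _ (avg (fun s => agree u z s + q.+1%:R^-1))).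
  apply: avg_le => s; apply: le_trans (ler_normB _ _) _.
  by rewrite !ger0_norm ?invr_ge0 ?ler0n.
by rewrite avgD avg_cst avg_agree // mulr_natl mulr2n.
Qed.

Lemma avg_sqr_cagree u z : u != z ->
  avg (fun s => cagree u z s ^+ 2) = q.+1%:R^-1 * (1 - q.+1%:R^-1).
Proof.
move=> uz; pose k : R := q.+1%:R^-1.
rewrite (avg_ext (G := fun s => (1 - 2 * k) * agree u z s + k ^+ 2)) => [|s].
  by rewrite avgD avg_cst avgZ avg_agree // -/k; ring.
by rewrite /cagree /agree -/k; case: (_ == _) => /=; ring.
Qed.

Variables (v kap : R).
(** The conditional variance of an edge indicator has this form, v being its mean over
    the labelings. *)
Definition weight e s : R := v + kap * eagree e s.

Lemma local_eagree B e : ends e \subset B -> local_on B (eagree e).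
Proof.
by rewrite subUset !sub1set => /andP[uB wB] s t st; rewrite /eagree /cagree /agree !st.
Qed.

Lemma local_prod B A (f : edge n -> Lab -> R) :
  (forall e, e \in A -> local_on B (f e)) -> local_on B (fun s => \prod_(e in A) f e s).
Proof. by move=> lf s t st; apply: eq_bigr => e eA; apply: lf. Qed.

Lemma local_weight B e : ends e \subset B -> local_on B (weight e).
Proof. by move=> eB s t st; rewrite /weight (local_eagree eB st). Qed.

(** Integrate out the vertices of the path from its far end: each time the fluctuating
    part of the last edge averages to zero. *)
Lemma avg_weight_path u p F : uniq (u :: p) -> local_on (~: [set:: p]) F ->
  avg (fun s => F s * \prod_(e in walk_edges u p) weight e s) = v ^+ size p * avg F.
Proof.
elim/last_ind: p => [|p w IH] up lF.
  rewrite mul1r; apply: avg_ext => s; rewrite big_set0 mulr1 //.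
have uw : last u p != w.
  move: up; rewrite -rcons_cons rcons_uniq => /andP[+ _].
  by apply: contraNneq => <-; exact: mem_last.
have /cards1P[e je] : #|joins (last u p) w| == 1%N by rewrite cards_joins.
have ej : e \in joins (last u p) w by rewrite je inE.
have up' : uniq (u :: p) by move: up; rewrite -rcons_cons rcons_uniq => /andP[].
have wp : w \notin u :: p by move: up; rewrite -rcons_cons rcons_uniq => /andP[].
have ep : e \notin walk_edges u p.
  apply/negP => /walk_edges_ends; rewrite (joins_ends ej) subUset !sub1set => /andP[_].
  by rewrite inE (negPf wp).
have lF' : local_on (~: [set w]) (fun s => F s * \prod_(e in walk_edges u p) weight e s).
  apply: local_mul.
    apply: local_sub lF; rewrite setCS; apply/subsetP => z; rewrite !inE => /eqP ->.
    by rewrite mem_rcons inE eqxx.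
  apply: local_prod => e' /walk_edges_ends e'p; apply: local_weight.
  apply: subset_trans e'p _; apply/subsetP => z; rewrite !inE => zp.
  by apply: contraNneq wp => <-; rewrite inE.
have -> : walk_edges u (rcons p w) = e |: walk_edges u p.
  by rewrite -cats1 walk_edges_cat /= setU0 je setUC.
have E s : F s * \prod_(e0 in e |: walk_edges u p) weight e0 s =
   v * (F s * \prod_(e in walk_edges u p) weight e s) +
   kap * ((F s * \prod_(e in walk_edges u p) weight e s) * cagree (last u p) w s).
  by rewrite big_setU1 //= {1}/weight (eagree_joins s ej); ring.
rewrite (avg_ext E) avgD !avgZ (avg_cagree0 uw lF') mulr0 addr0 IH //; last first.
  by apply: local_sub lF; rewrite setCS; apply/subsetP => z; rewrite !inE mem_rcons inE => ->; rewrite orbT.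
by rewrite size_rcons exprS mulrA.
Qed.

(** For kap >= 0 the weights are positive definite and dominate the constant v, so
    their correlations can only help. *)
Lemma avg_weight_ge_pos S : 0 <= v -> 0 <= kap ->
  v ^+ #|S| <= avg (fun s => \prod_(e in S) weight e s).
Proof.
move=> v0 kap0.
have [_ pdw] := @pd_prod_le R n q (enum S) (fun _ _ => v) weight (fun=> pd_cst n q v0)
  (fun e => pd_ext (fun s => esym (etrans (congr1 (fun y => y - v) (addrC _ _)) (addrK _ _)))
     (pd_mul (pd_cst n q kap0) (pd_eagree e))).
have := pd_avg_ge0 pdw.
rewrite (avg_ext (G := fun s => \prod_(e in S) weight e s + - v ^+ #|S|)) => [|s].
  by rewrite avgD avg_cst subr_ge0.
by rewrite !big_enum /= prodr_const.
Qed.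

(** In each ear after the first, bound one edge by its minimum d v; what remains is a
    path with a free end, which averages exactly to a power of v. The first ear joins
    the two roots, one of which is free, so nothing is lost there and the exponent of
    d is one less than the number of ears. *)
Lemma avg_weight_ge_ears (d : R) k S : 0 <= v -> 0 <= d <= 1 ->
  (forall e s, d * v <= weight e s) ->
  ears set0 k.+1 S -> v ^+ #|S| * d ^+ k <= avg (fun s => \prod_(e in S) weight e s).
Proof.
move=> v0 /andP[d0 d1] dw.
have w0 e s : 0 <= weight e s by apply: le_trans (dw e s); rewrite mulr_ge0.
move mk: k.+1 => m gS; elim: gS k mk => // {}m S' u p w gS' IH ear k [mk].
have pw0 A s : 0 <= \prod_(e in A) weight e s by apply: prodr_ge0.
have splitP s : \prod_(e in S' :|: walk_edges u (rcons p w)) weight e s =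
   \prod_(e in S') weight e s * \prod_(e in walk_edges u (rcons p w)) weight e s.
  rewrite -bigU /=; last by rewrite disjoint_sym; case/and5P: ear.
  by apply: eq_bigl => e; rewrite !inE.
rewrite (cards_ear ear) (avg_ext splitP).
have up : uniq (u :: rcons p w) by case/and5P: ear.
(* The first ear starts from the empty set: its far end is a free vertex as well. *)
case: k mk => [|k] mk.
  have S'0 : S' = set0 by move: gS'; rewrite -mk => gS'; inversion gS'.
  rewrite S'0 cards0 mulr1 (avg_ext (G := fun s =>
     1 * \prod_(e in walk_edges u (rcons p w)) weight e s)); last first.
    by move=> s; rewrite big_set0.
  by rewrite avg_weight_path // avg_cst mulr1 size_rcons add0n.
have wp : w \notin u :: p by move: up; rewrite -rcons_cons rcons_uniq => /andP[].
have up' : uniq (u :: p) by move: up; rewrite -rcons_cons rcons_uniq => /andP[].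
have uw : last u p != w by apply: contraNneq wp => <-; exact: mem_last.
have /cards1P[e je] : #|joins (last u p) w| == 1%N by rewrite cards_joins.
have ej : e \in joins (last u p) w by rewrite je inE.
have ep : e \notin walk_edges u p.
  apply/negP => /walk_edges_ends; rewrite (joins_ends ej) subUset !sub1set => /andP[_].
  by rewrite inE (negPf wp).
have wE : walk_edges u (rcons p w) = e |: walk_edges u p.
  by rewrite -cats1 walk_edges_cat /= setU0 je setUC.
apply: (@le_trans _ _ (avg (fun s => d * v *
   (\prod_(e in S') weight e s * \prod_(e in walk_edges u p) weight e s)))); last first.
  apply: avg_le => s; rewrite wE big_setU1 //= mulrCA.
  by apply: ler_wpM2l => //; apply: ler_wpM2r.
rewrite avgZ avg_weight_path //; last first.
  apply: local_prod => e' e'S; apply: local_weight.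
  apply: subset_trans (ends_touched r r' e'S) _; apply/subsetP => z zS; rewrite !inE.
  by apply/negP => zp; case/and5P: ear => _ _ _ /allP /(_ z zp); rewrite /= zS.
rewrite addnS exprS exprD exprS.
have -> : v * (v ^+ #|S'| * v ^+ size p) * (d * d ^+ k)
  = d * v * (v ^+ size p * (v ^+ #|S'| * d ^+ k)) by ring.
rewrite ler_wpM2l ?mulr_ge0 // ler_wpM2l ?exprn_ge0 //; exact: IH.
Qed.
End Kernel.

(** * Good edge sets and their levels *)

(** Forward substitution along the cardinality of the sets. *)
Lemma triangular_solution (R : fieldType) (E : finType) (P : pred {set E})
    (A : {set E} -> {set E} -> R) (c : {set E} -> R) :
  (forall S, P S -> A S S != 0) ->
  exists u : {set E} -> R,
    forall S, P S -> \sum_(T : {set E} | (T \subset S) && P T) A S T * u T = c S.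
Proof.
move=> A0.
have sumE u S : P S -> \sum_(T : {set E} | (T \subset S) && P T) A S T * u T =
    A S S * u S + \sum_(T : {set E} | (T \proper S) && P T) A S T * u T.
  move=> PS; rewrite (bigD1 S) ?subxx //=; congr (_ + _); apply: eq_bigl => T.
  by rewrite properEneq andbC andbA.
suff [m [u [lt_m uP]]] : exists m (u : {set E} -> R), (#|E| < m)%N /\
    forall S : {set E}, (#|S| < m)%N -> P S -> \sum_(T : {set E} | (T \subset S) && P T) A S T * u T = c S.
  by exists u => S PS; apply: uP => //; apply: leq_ltn_trans (max_card _) lt_m.
exists #|E|.+1; elim: #|E|.+1 => [|m [u [_ uP]]]; first by exists (fun=> 0).
pose u' (S : {set E}) := if #|S| == m
  then (c S - \sum_(T : {set E} | (T \proper S) && P T) A S T * u T) / A S S else u S.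
have u'E (S : {set E}) : (#|S| <= m)%N -> \sum_(T : {set E} | (T \proper S) && P T) A S T * u' T =
    \sum_(T : {set E} | (T \proper S) && P T) A S T * u T.
  move=> Sm; apply: eq_bigr => T /andP[/proper_card TS _]; rewrite /u'.
  by rewrite ltn_eqF // (leq_trans TS).
exists u'; split=> // S; rewrite ltnS leq_eqVlt => /orP[/eqP Sm|Sm] PS.
  rewrite sumE // u'E ?Sm // {1}/u' Sm eqxx mulrC divfK ?A0 //.
  exact: subrK.
rewrite -(uP S Sm PS); apply: eq_bigr => T /andP[TS _]; rewrite /u' ltn_eqF //.
exact: leq_ltn_trans (subset_leq_card TS) Sm.
Qed.

Section Levels.
Variables (n : nat) (r r' : 'I_n).
Hypothesis neq_roots : r != r'.
Implicit Types (S T U M : {set edge n}).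
Local Notation touched := (touched r r').
Local Notation ears := (ears r r').
Local Notation is_ear := (is_ear r r').

Definition good S : bool := `[< exists k, ears set0 k S >].

(** The number of ears in any construction of a good set, by [ears_level]. *)
Definition level S : nat := (#|S| + 2 - #|touched S|)%N.

Lemma card_touched0 : #|touched set0| = 2%N.
Proof. by rewrite touched0 cards2 neq_roots. Qed.

Lemma ears_level k S : ears set0 k S -> k = level S /\ (#|S| + 2 = #|touched S| + k)%N.
Proof.
move/ears_card; rewrite cards0 card_touched0 add0n => H; split=> //.
by rewrite /level H addKn.
Qed.

Lemma goodP S : reflect (ears set0 (level S) S) (good S).
Proof.
apply: (iffP (asboolP _)) => [[k gS]|gS]; last by exists (level S).
by have [<-] := ears_level gS.
Qed.

Lemma card_touched S : good S -> (#|S| + 2 = #|touched S| + level S)%N.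
Proof. by move/goodP/ears_level => []. Qed.

Lemma ears0_inv T S : ears T 0 S -> S = T.
Proof. by move=> TS; inversion TS. Qed.

Lemma good0 : good set0.
Proof. by apply/asboolP; exists 0; exact: Ears0. Qed.

Lemma level_eq0 S : good S -> (level S == 0) = (S == set0).
Proof.
move=> /goodP gS; apply/eqP/eqP => [l0|->]; first by move: gS; rewrite l0 => /ears0_inv.
by rewrite /level cards0 card_touched0.
Qed.

Lemma good_between T S : good T -> good S -> T \subset S ->
  exists2 j, ears T j S & level S = (level T + j)%N.
Proof.
move=> /goodP gT /goodP gS TS; have [j TjS] := ears_between gS TS.
exists j => //; have [<- _] := ears_level (ears_trans gT TjS); exact: addnC.
Qed.

Lemma level_lt T S : good T -> good S -> T \proper S -> (level T < level S)%N.
Proof.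
move=> gT gS TS; have [[|j] TjS ->] := good_between gT gS (proper_sub TS).
  by move: TS; rewrite (ears0_inv TjS) properxx.
by rewrite addnS ltnS leq_addr.
Qed.

Lemma level_le_card S : good S -> (level S <= #|S|)%N.
Proof.
move=> gS; have := card_touched gS; have := subset_leq_card (touchedS r r' (sub0set S)).
rewrite card_touched0; lia.
Qed.

(** Attach ears inside S as long as possible. The result contains every good subset of
    S because it has no ear left to absorb one. *)
Lemma max_good S : exists M, [/\ good M, M \subset S,
  (forall u p v, is_ear M u p v -> ~~ (walk_edges u (rcons p v) \subset S))
  & forall T, good T -> T \subset S -> T \subset M].
Proof.
have [k [M [gM MS noear]]] := ears_saturate r r' (sub0set S).
exists M; split=> //; first by apply/asboolP; exists k.
by move=> T /goodP gT TS; exact: ears_absorb gT TS noear.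
Qed.

Lemma good_ear S : good S -> S != set0 -> exists T u p v,
  [/\ good T, is_ear T u p v, S = T :|: walk_edges u (rcons p v) & level S = (level T).+1].
Proof.
move=> gS; rewrite -level_eq0 // => l0; have /goodP := gS.
move: l0; case lS : (level S) => [//|k] _ eS; inversion eS as [|? T u p v gT ear]; subst.
exists T, u, p, v; split=> //; first by apply/asboolP; exists k.
by have [->] := ears_level gT.
Qed.

(** The function h counts, with weights, the chains of nonempty good sets ending at S;
    it majorises the normalised solution of the triangular system. *)
Section ChainWeights.
Variables (R : realFieldType) (h : {set edge n} -> R).
Hypothesis hE : forall S, good S && (S != set0) ->
  h S = 2 + \sum_(T : {set edge n} | (T \proper S) && (good T && (T != set0))) h T.

Lemma chain_weight_ge0 S : good S && (S != set0) -> 0 <= h S.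
Proof.
have [m] := ubnP #|S|; elim: m S => // m IH S ltm gS; rewrite hE //.
rewrite addr_ge0 ?ler0n // sumr_ge0 // => T /andP[TS gT]; apply: IH => //.
by have := proper_card TS; lia.
Qed.

(** A good proper subset of S misses some edge e of S, hence lies below the largest
    good subset of S minus e, whose level is smaller. There are at most m choices of e
    for each unit of level, so the sum grows by a factor 1 + 2 m for each level. *)
Lemma sum_chain_weight m k S : good S -> (#|S| <= m)%N -> level S = k.+1 ->
  \sum_(T : {set edge n} | (T \subset S) && (good T && (T != set0))) h T <= 2 * (1 + 2 * m%:R) ^+ k.
Proof.
have [K] := ubnP k; elim: K k S => // K IH k S ltk gS Sm lS.
have SN0 : S != set0 by rewrite -level_eq0 // lS.
have gS' : good S && (S != set0) by rewrite gS.
pose Q (T : {set edge n}) := good T && (T != set0).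
have c0 : 0 <= 1 + 2 * m%:R :> R by rewrite addr_ge0 ?mulr_ge0 ?ler0n.
pose b : R := if k is k'.+1 then 2 * (1 + 2 * m%:R) ^+ k' else 0.
have b0 : 0 <= b by rewrite /b; case: (k) => // k'; rewrite mulr_ge0 ?exprn_ge0.
have inner e : e \in S -> \sum_(T : {set edge n} | (T \subset S :\ e) && Q T) h T <= b.
  move=> eS; have [M [gM MS _ maxM]] := max_good (S :\ e).
  (* Good subsets avoiding e are contained in M, which has a smaller level. *)
  have pMS : M \proper S by apply: sub_proper_trans MS _; rewrite properD1.
  have lM := level_lt gM gS pMS.
  have [M0|MN0] := eqVneq M set0.
    rewrite big1 // => T /andP[TS /andP[gT TN0]].
    by move: (maxM T gT TS); rewrite M0 subset0 (negPf TN0).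
  have [j lMj] : exists j, level M = j.+1.
    by case: (level M) (level_eq0 gM) => [|j _]; [rewrite (negPf MN0)|exists j].
  apply: (@le_trans _ _ (\sum_(T : {set edge n} | (T \subset M) && Q T) h T)).
    rewrite [leRHS](bigID (fun T : {set edge n} => T \subset S :\ e)) /= -[leLHS]addr0 lerD //.
      rewrite le_eqVlt; apply/orP; left; apply/eqP; apply: eq_bigl => T.
      rewrite /Q; case gT: (good T); rewrite ?andbF //= ?andbF //.
      apply/idP/idP => [/andP[TS ->]|/andP[/andP[_ ->] ->] //].
      by rewrite TS (maxM T gT TS).
    by apply: sumr_ge0 => T /andP[/andP[_ /chain_weight_ge0]].
  rewrite /b; move: lM; rewrite lS lMj ltnS; case: (k) ltk => // k' ltk jk.
  apply: le_trans (IH j M _ gM _ lMj) _; first by lia.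
    by apply: leq_trans Sm; rewrite subset_leq_card // proper_sub.
  by rewrite ler_wpM2l ?ler0n // ler_weXn2l // lerDl mulr_ge0 ?ler0n.
have rest : \sum_(T : {set edge n} | (T \proper S) && Q T) h T <= m%:R * b.
  apply: (@le_trans _ _ (\sum_(e in S) \sum_(T : {set edge n} | (T \subset S :\ e) && Q T) h T)).
    rewrite (exchange_big_dep (fun T : {set edge n} => (T \proper S) && Q T)) /=; last first.
      move=> e T eS /andP[TS ->]; rewrite andbT; apply: sub_proper_trans TS _.
      by rewrite properD1.
    apply: ler_sum => T /andP[TS QT]; have /properP[sTS [e eS eT]] := TS.
    rewrite (bigD1 e) /=; last by rewrite eS subsetD1 sTS eT.
    by rewrite lerDl sumr_ge0 // => _ _; exact: chain_weight_ge0.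
  apply: (@le_trans _ _ (\sum_(e in S) b)); first exact: ler_sum.
  by rewrite sumr_const -[b *+ _]mulr_natl ler_wpM2r // ler_nat.
have -> : \sum_(T : {set edge n} | (T \subset S) && Q T) h T
    = 2 + 2 * \sum_(T : {set edge n} | (T \proper S) && Q T) h T.
  rewrite (bigD1 S) ?subxx //= (eq_bigl (fun T : {set edge n} => (T \proper S) && Q T)).
    by rewrite hE // -/Q; ring.
  by move=> T; rewrite properEneq andbC andbA.
apply: (@le_trans _ _ (2 + 2 * (m%:R * b))); first by rewrite lerD2l ler_wpM2l ?ler0n.
rewrite /b; case: (k) => [|k']; first by rewrite !mulr0 addr0 expr0 mulr1.
have X1 : 1 <= (1 + 2 * m%:R) ^+ k' :> R by rewrite exprn_ege1 // lerDl mulr_ge0 ?ler0n.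
by move: X1; rewrite exprS; set X := _ ^+ k'; lra.
Qed.
End ChainWeights.
End Levels.

(** * The dual certificate *)

Section Certificate.
Variables (R : realType) (n q : nat) (r r' : 'I_n) (lam v kap : R).
Hypothesis neq_roots : r != r'.
Local Notation Lab := {ffun 'I_n -> 'I_q.+1}.
Local Notation touched := (touched r r').
Local Notation ears := (ears r r').
Local Notation good := (good r r').
Local Notation level := (level r r').
Local Notation k := (q.+1%:R : R).
Implicit Types (S T M : {set edge n}) (s : Lab).

Definition weights T s : R := \prod_(e in T) weight v kap e s.
Definition eagrees T s : R := \prod_(e in T) eagree R e s.
(** The coefficient of u_T in the equation of the dual system tested on the edge set
    S, whose right-hand side is [target]. *)
Definition moment S T : R :=
  lam ^+ #|S :\: T| * avg (fun s => weights T s * eagrees (S :\: T) s).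
Definition target S : R :=
  lam ^+ #|S| * avg (fun s => cagree R r r' s * eagrees S s).

Lemma local_weights T : local_on (touched T) (weights T).
Proof. by apply: local_prod => e eT; apply/local_weight/ends_touched. Qed.

Lemma local_eagrees T : local_on (touched T) (eagrees T).
Proof. by apply: local_prod => e eT; apply/local_eagree/ends_touched. Qed.

Lemma local_roots T : local_on (touched T) (@cagree R n q r r').
Proof.
have := roots_touched r r' T; rewrite subUset !sub1set => /andP[rT r'T] s t st.
by rewrite /cagree /agree !st.
Qed.

Lemma big_split_sub (f : edge n -> R) S M : M \subset S ->
  \prod_(e in S) f e = \prod_(e in M) f e * \prod_(e in S :\: M) f e.
Proof. by move=> MS; rewrite (big_setID M) /= (setIidPr MS). Qed.

Lemma moment_diag S : moment S S = avg (@weights S).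
Proof.
rewrite /moment setDv cards0 expr0 mul1r; apply: avg_ext => s.
by rewrite /eagrees big_set0 mulr1.
Qed.

(** Solve the system on good sets only. For an arbitrary S with largest good subset M,
    the edges of S minus M multiply every term of the equation of M by one and the
    same constant, so the equation of S follows from that of M. *)
Lemma certificate_exists : (forall S, good S -> avg (@weights S) != 0) ->
  exists u : {set edge n} -> R, forall S,
    \sum_(T : {set edge n} | (T \subset S) && good T) moment S T * u T = target S.
Proof.
move=> W0; have A0 S : good S -> moment S S != 0.
  by move=> /W0; rewrite moment_diag.
have [u uP] := triangular_solution target A0; exists u => S.
have [M [gM MS noear maxM]] := max_good neq_roots S.
have [c cE] := avg_saturated R q noear.
have momE T : T \subset M -> moment S T = lam ^+ #|S :\: M| * c * moment M T.
  rewrite /moment => TM; have -> : #|S :\: T| = (#|S :\: M| + #|M :\: T|)%N.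
    rewrite !cardsDS ?(subset_trans TM) //.
    by rewrite addnBA ?subset_leq_card // subnK ?subset_leq_card.
  suff -> : avg (fun s => weights T s * eagrees (S :\: T) s)
      = c * avg (fun s => weights T s * eagrees (M :\: T) s) by rewrite exprD mulrACA.
  rewrite -cE; last first.
    apply: local_mul; first exact: local_sub (touchedS r r' TM) (@local_weights T).
    by apply: local_sub (@local_eagrees _); apply: touchedS; exact: subsetDl.
  apply: avg_ext => s; rewrite /= -mulrA; congr (_ * _).
  rewrite /eagrees (@big_split_sub _ (S :\: T) (M :\: T)) ?setSD //; congr (_ * _).
  apply: eq_bigl => e; rewrite !inE; have := subsetP TM e.
  by case: (e \in T) => [/(_ isT) -> //|_]; case: (e \in M).
transitivity (lam ^+ #|S :\: M| * c * target M).
  rewrite -uP // mulr_sumr (eq_bigl (fun T : {set edge n} => (T \subset M) && good T)).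
    by apply: eq_bigr => T /andP[TM _]; rewrite momE // -mulrA.
  move=> T; case gT: (good T); rewrite ?andbF ?andbT //.
  by apply/idP/idP => [/(maxM T gT)|/subset_trans ->].
rewrite /target.
have -> : #|S| = (#|S :\: M| + #|M|)%N by rewrite cardsDS // subnK // subset_leq_card.
suff -> : avg (fun s => cagree R r r' s * eagrees S s)
    = c * avg (fun s => cagree R r r' s * eagrees M s) by rewrite exprD mulrACA.
rewrite -cE; last by apply: local_mul; [exact: local_roots|exact: local_eagrees].
by apply: avg_ext => s; rewrite /= -mulrA /eagrees -big_split_sub.
Qed.

Variables (d : R) (D : nat) (u : {set edge n} -> R).
Hypotheses (v_gt0 : 0 < v) (d_gt0 : 0 < d).
Hypothesis weight_ge0 : forall e s, 0 <= weight v kap e s.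
Hypothesis weights_ge : forall j S, ears set0 j.+1 S ->
  v ^+ #|S| * d ^+ j <= avg (@weights S).
Hypothesis uP : forall S,
  \sum_(T : {set edge n} | (T \subset S) && good T) moment S T * u T = target S.

Lemma weights_ge0 T s : 0 <= weights T s.
Proof. by apply: prodr_ge0. Qed.

(** The empty set gives no contribution because x has mean zero; this removes the only
    set of level 0. *)
Lemma certificate0 : u set0 = 0.
Proof.
have := uP set0; rewrite (bigD1 set0) ?sub0set ?good0 //= big1 => [|T]; last first.
  by rewrite subset0 => /andP[/andP[/eqP ->]]; rewrite eqxx.
rewrite /moment /target setDv cards0 !mul1r addr0.
rewrite (avg_ext (G := fun=> 1)) => [|s]; last by rewrite /weights /eagrees !big_set0 mulr1.
rewrite avg_cst mul1r => ->.
rewrite (avg_ext (G := fun s => 1 * cagree R r r' s)) => [|s]; last first.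
  by rewrite /eagrees big_set0 mulr1 mul1r.
by apply: avg_cagree0.
Qed.

Lemma target_le S : good S -> S != set0 ->
  `|target S| <= 2 * k ^+ (level S).-1 * (`|lam| / k) ^+ #|S|.
Proof.
move=> gS SN0; have /goodP := gS => /(_ neq_roots) eS.
have k0 := qpos R q.
have := avg_ears_le eS (@local_roots set0); rewrite setD0 => H.
have cS := card_touched neq_roots gS.
have lS : level S != 0 by rewrite level_eq0.
rewrite /target normrM normrX.
apply: le_trans (ler_wpM2l _ (le_trans H (ler_wpM2l _ (avg_norm_cagree R q neq_roots)))) _.
- by rewrite exprn_ge0.
- by rewrite invr_ge0 exprn_ge0 // ltW.
rewrite card_touched0 // expr_div_n le_eqVlt; apply/orP; left; apply/eqP.
have -> : #|S| = (#|touched S| - 2 + (level S).-1.+1)%N.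
  by have := subset_leq_card (touchedS r r' (sub0set S)); rewrite card_touched0 //; lia.
rewrite [k ^+ (_ + _)]exprD exprS.
have kN0 := lt0r_neq0 k0.
set X := `|lam| ^+ _; set K1 := k ^+ _; set K2 := k ^+ _.
have : K1 != 0 by rewrite expf_neq0.
have : K2 != 0 by rewrite expf_neq0.
move: kN0; move: K1 K2 X k => K1 K2 X k kN0 ? ?.
by field; rewrite kN0; apply/andP.
Qed.

(** Stated in product form because lam may vanish. Division by the powers of k and
    |lam| shows the content: in units of (|lam| / k)^|S|, passing from T to S costs
    one factor k for each ear. *)
Lemma moment_le S T : good S -> good T -> T \subset S ->
  `|moment S T| * (`|lam| / k) ^+ #|T| * k ^+ level T
    <= avg (@weights T) * k ^+ level S * (`|lam| / k) ^+ #|S|.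
Proof.
move=> gS gT TS; have [j TjS lS] := good_between neq_roots gT gS TS.
have k0 := qpos R q; have kN0 := lt0r_neq0 k0.
have := avg_ears_le TjS (@local_weights T).
rewrite [in X in _ <= X -> _](avg_ext (G := weights T)) => [H|s]; last first.
  by rewrite ger0_norm ?weights_ge0.
have cS := card_touched neq_roots gS; have cT := card_touched neq_roots gT.
have tTS := subset_leq_card (touchedS r r' TS); have cTS := subset_leq_card TS.
rewrite /moment normrM normrX !expr_div_n.
have -> : #|S :\: T| = (#|touched S| - #|touched T| + j)%N by rewrite cardsDS //; lia.
have -> : #|S| = (#|touched S| - #|touched T| + j + #|T|)%N by lia.
move: H; rewrite lS; set m := (_ - _)%N => H.
apply: (@le_trans _ _ (`|lam| ^+ (m + j) * ((k ^+ m)^-1 * avg (weights T))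
    * (`|lam| ^+ #|T| / k ^+ #|T|) * k ^+ level T)).
  apply: ler_wpM2r; first by rewrite exprn_ge0 // ltW.
  apply: ler_wpM2r; first by rewrite divr_ge0 ?exprn_ge0 // ltW.
  by apply: ler_wpM2l H; rewrite exprn_ge0.
rewrite !exprD le_eqVlt; apply/orP; left; apply/eqP.
have := expf_neq0 m kN0; have := expf_neq0 j kN0; have := expf_neq0 #|T| kN0.
move: (`|lam| ^+ m) (`|lam| ^+ j) (`|lam| ^+ #|T|) (k ^+ m) (k ^+ j) (k ^+ #|T|).
move: (k ^+ level T) (avg _) => b w x y z K J L L0 J0 K0.
by field; rewrite K0 J0 L0.
Qed.

Lemma weights_gt0 S : good S -> 0 < avg (@weights S).
Proof.
move=> gS; have [->|SN0] := eqVneq S set0.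
  by rewrite (avg_ext (G := fun=> 1)) ?avg_cst // => s; rewrite /weights big_set0.
have lS : level S = (level S).-1.+1.
  by have := level_eq0 neq_roots gS; rewrite (negPf SN0); case: level.
apply: lt_le_trans (weights_ge (j := (level S).-1) _); last by rewrite -lS; apply/goodP.
by rewrite mulr_gt0 ?exprn_gt0.
Qed.

(** In units of k^(level - 1) (|lam| / k)^|S| the recursion for u loses its dependence
    on the parameters and becomes that of the chain weights h. *)
Lemma certificate_le (h : {set edge n} -> R) :
  (forall S, good S && (S != set0) ->
    h S = 2 + \sum_(T : {set edge n} | (T \proper S) && (good T && (T != set0))) h T) ->
  forall S, good S && (S != set0) ->
    `|u S| * avg (@weights S) <= h S * k ^+ (level S).-1 * (`|lam| / k) ^+ #|S|.
Proof.
move=> hE S; have [m] := ubnP #|S|; elim: m S => // m IH S ltm gS0.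
have [gS SN0] := andP gS0.
have k0 := qpos R q; have kN0 := lt0r_neq0 k0.
have lS : level S = (level S).-1.+1 by have := level_eq0 neq_roots gS; rewrite (negPf SN0); case: level.
pose Q (T : {set edge n}) := good T && (T != set0).
have W0 T : 0 <= avg (weights T) by apply: avg_ge0 => s; apply: weights_ge0.
have uE : u S * avg (weights S) = target S -
    \sum_(T : {set edge n} | (T \proper S) && Q T) moment S T * u T.
  rewrite -uP (bigD1 S) ?subxx //=.
  have -> : moment S S = avg (weights S) by exact: moment_diag.
  rewrite [X in _ + X - _](bigID (fun T : {set edge n} => T != set0)) /=.
  rewrite [X in _ + (_ + X) - _]big1 ?addr0 => [|T]; last first.
    by rewrite negbK => /andP[_ /eqP ->]; rewrite certificate0 mulr0.
  rewrite (eq_bigl (fun T : {set edge n} => (T \proper S) && Q T)).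
    by rewrite addrK mulrC.
  by move=> T; rewrite properEneq /Q; case: (T \subset S); case: (good T); case: (T != S); case: (T != set0).
rewrite -[X in _ * X]ger0_norm // -normrM uE; apply: le_trans (ler_normB _ _) _.
rewrite hE // -/Q 2!mulrDl; apply: lerD; first exact: target_le.
apply: le_trans (ler_norm_sum _ _ _) _.
rewrite -mulrA mulr_suml; apply: ler_sum => T /andP[TS QT]; have [gT TN0] := andP QT.
have lT : level T = (level T).-1.+1 by have := level_eq0 neq_roots gT; rewrite (negPf TN0); case: level.
have w0 : 0 < avg (weights T) by apply: weights_gt0.
have H1 := IH T (leq_trans (proper_card TS) ltm) QT.
have := moment_le gS gT (proper_sub TS).
rewrite lS lT /= !exprS [leLHS]mulrCA [leRHS]mulrAC [leRHS]mulrCA ler_pM2l // => H2.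
have hT := chain_weight_ge0 neq_roots hE QT.
rewrite [leLHS]normrM -(ler_pM2r w0) -[leLHS]mulrA.
apply: le_trans (ler_wpM2l (normr_ge0 _) H1) _.
move: H2 hT; move: `|moment S T| ((`|lam| / k) ^+ #|T|) (k ^+ (level T).-1) (h T) (avg _).
move: ((`|lam| / k) ^+ #|S|) (k ^+ (level S).-1) => z y a b c e w H2 e0.
have -> : a * (e * c * b) = e * (a * b * c) by ring.
have -> : e * (y * z) * w = e * (w * z * y) by ring.
exact: ler_wpM2l.
Qed.

(** The bound on u_S E[weights] is squared and divided by the lower bound on
    E[weights]. *)
Lemma certificate_norm_le :
  \sum_(T : {set edge n} | good T && (#|T| <= D)%N) u T ^+ 2 * avg (@weights T) <=
  4 * \sum_(T : {set edge n} | [&& good T, T != set0 & (#|T| <= D)%N])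
     ((1 + 2 * D%:R) ^+ 2 * k ^+ 2 / d) ^+ (level T).-1
     * (lam ^+ 2 / (k ^+ 2 * v)) ^+ #|T|.
Proof.
(* The chain weights solve a triangular system as well. *)
pose A (S T : {set edge n}) : R := if S == T then 1 else -1.
have A0 S : good S && (S != set0) -> A S S != 0 by rewrite /A eqxx oner_neq0.
have [h hP] := triangular_solution (fun=> 2) A0.
have hE S : good S && (S != set0) ->
    h S = 2 + \sum_(T : {set edge n} | (T \proper S) && (good T && (T != set0))) h T.
  move=> gS; rewrite -(hP S gS) (bigD1 S) ?subxx //= /A eqxx mul1r -addrA -[LHS]addr0.
  congr (_ + _); apply/esym/eqP; rewrite addr_eq0 -sumrN; apply/eqP.
  apply: eq_big => [T|T /andP[_ TS]].
    by rewrite properEneq; case: (T \subset S); case: (good T); case: (T != S); case: (T != set0).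
  by rewrite eq_sym (negPf TS) mulN1r.
have k0 := qpos R q; have kN0 := lt0r_neq0 k0.
rewrite mulr_sumr [leLHS](bigID (fun T : {set edge n} => T == set0)) /=.
rewrite [X in X + _]big1 ?add0r => [|T /andP[_ /eqP ->]]; last first.
  by rewrite certificate0 expr0n mul0r.
rewrite (eq_bigl (fun T : {set edge n} => [&& good T, T != set0 & (#|T| <= D)%N])); last first.
  by move=> T; rewrite -andbA [X in _ && X]andbC.
apply: ler_sum => S /and3P[gS SN0 SD].
have gS0 : good S && (S != set0) by rewrite gS.
have lS : level S = (level S).-1.+1 by have := level_eq0 neq_roots gS; rewrite (negPf SN0); case: level.
have w0 := weights_gt0 gS.
have H := certificate_le hE gS0.
have hS : h S <= 2 * (1 + 2 * D%:R) ^+ (level S).-1.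
  apply: le_trans _ (sum_chain_weight neq_roots hE gS SD lS).
  rewrite (bigD1 S) ?subxx //= lerDl sumr_ge0 // => T /andP[/andP[_ QT] _].
  exact: (chain_weight_ge0 neq_roots hE QT).
have W : v ^+ #|S| * d ^+ (level S).-1 <= avg (weights S).
  by apply: weights_ge; rewrite -lS; apply/goodP.
have {}H : `|u S| * avg (weights S) <=
    2 * (1 + 2 * D%:R) ^+ (level S).-1 * k ^+ (level S).-1 * (`|lam| / k) ^+ #|S|.
  apply: le_trans H _; apply: ler_wpM2r; first by rewrite exprn_ge0 // divr_ge0 // ltW.
  by apply: ler_wpM2r hS; rewrite exprn_ge0 // ltW.
rewrite -(ler_pM2r w0).
have -> : u S ^+ 2 * avg (weights S) * avg (weights S) = (`|u S| * avg (weights S)) ^+ 2.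
  by rewrite exprMn real_normK ?num_real // -mulrA.
have lhs0 : 0 <= `|u S| * avg (weights S) by rewrite mulr_ge0 // ltW.
apply: (@le_trans _ _ ((2 * (1 + 2 * D%:R) ^+ (level S).-1 * k ^+ (level S).-1
    * (`|lam| / k) ^+ #|S|) ^+ 2)); first by rewrite ler_sqr ?nnegrE // (le_trans lhs0).
have B0 : 0 <= (1 + 2 * D%:R) ^+ 2 * k ^+ 2 / d.
  by apply: divr_ge0 (ltW d_gt0); apply: mulr_ge0; apply: sqr_ge0.
have Y0 : 0 <= lam ^+ 2 / (k ^+ 2 * v).
  by apply: divr_ge0; rewrite ?sqr_ge0 // mulr_ge0 ?sqr_ge0 // ltW.
apply: le_trans (ler_wpM2l _ W); last by rewrite !mulr_ge0 ?exprn_ge0.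
rewrite le_eqVlt; apply/orP; left; apply/eqP.
rewrite -[lam ^+ 2]real_normK ?num_real //.
have dN0 := lt0r_neq0 d_gt0; have vN0 := lt0r_neq0 v_gt0.
move: (level S).-1 #|S| (1 + 2 * D%:R) `|lam| => j i c l.
move: k kN0 d dN0 v vN0 => K KN0 d' dN0 v' vN0.
rewrite !(expr_div_n, exprMn) -!exprM !exprM.
have := expf_neq0 i KN0; have := expf_neq0 j dN0; have := expf_neq0 i vN0.
move: (c ^+ j) (K ^+ j) (K ^+ i) (l ^+ i) (d' ^+ j) (v' ^+ i) => x1 x2 x3 x4 x5 x6 N1 N2 N3.
by field; rewrite N1 N2 N3.
Qed.
End Certificate.

(** * Counting good edge sets by levels *)

Lemma ler_sum_cover (R : numDomainType) (I J : finType) (P : pred I) (Q : pred J)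
    (F : J -> I) (f : I -> R) (g : J -> R) :
  (forall j, Q j -> 0 <= g j) ->
  (forall i, P i -> exists2 j, Q j & F j = i /\ f i <= g j) ->
  \sum_(i | P i) f i <= \sum_(j | Q j) g j.
Proof.
move=> g0 cover.
apply: (@le_trans _ _ (\sum_(i | P i) \sum_(j | Q j && (F j == i)) g j)).
  apply: ler_sum => i /cover[j Qj [Fj fg]]; apply: le_trans fg _.
  rewrite (bigD1 j) /=; last by rewrite Qj Fj eqxx.
  by rewrite lerDl sumr_ge0 // => j' /andP[/andP[/g0]].
rewrite (exchange_big_dep Q) /=; last by move=> i j _ /andP[].
apply: ler_sum => j Qj; rewrite Qj /=.
have [PF|NPF] := boolP (P (F j)).
  by rewrite (big_pred1 (F j)) // => i /=; rewrite eq_sym; case: eqP => [->|]; rewrite ?PF ?andbF.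
rewrite big1 ?g0 // => i /andP[Pi /eqP Fj]; by rewrite Fj Pi in NPF.
Qed.

Section Counting.
Variables (R : realFieldType) (n : nat) (r r' : 'I_n) (y : R) (D : nat).
Hypotheses (neq_roots : r != r') (y0 : 0 <= y).
Local Notation touched := (touched r r').
Local Notation good := (good r r').
Local Notation level := (level r r').
Implicit Types (S T : {set edge n}).

Definition level_sum j : R :=
  \sum_(T : {set edge n} | [&& good T, level T == j & (#|T| <= D)%N]) y ^+ #|T|.

(** The total weight of all sequences of at most D - 1 interior vertices of an ear, an
    ear with m interior vertices having m + 1 edges. *)
Definition path_sum : R := \sum_(m < D) n%:R ^+ m * y ^+ m.+1.

Lemma path_sum_ge0 : 0 <= path_sum.
Proof. by apply: sumr_ge0 => m _; rewrite mulr_ge0 ?exprn_ge0. Qed.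

Lemma level_sum0 : level_sum 0 = 1.
Proof.
rewrite /level_sum (big_pred1 set0) ?cards0 // => T /=.
have [gT|ngT] := boolP (good T); last first.
  by apply/esym/negP => /eqP T0; rewrite T0 good0 in ngT.
by rewrite level_eq0 //; case: eqP => // ->; rewrite cards0.
Qed.

(** Every good set of level j + 1 is a good set T of level j together with an ear,
    which is determined by its two ends among the touched vertices of T and by the
    sequence of its interior vertices. *)
Lemma level_sum_step j b :
  (forall T, good T -> level T = j -> (#|T| <= D)%N -> (#|touched T| <= b)%N) ->
  level_sum j.+1 <= b%:R ^+ 2 * path_sum * level_sum j.
Proof.
move=> bP.
pose I := ({set edge n} * ('I_n * 'I_n))%type.
pose J := {m : 'I_D & (m : nat).-tuple 'I_n}.
pose Q (i : I) := [&& good i.1, level i.1 == j & (#|i.1| <= D)%N] &&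
  ((i.2.1 \in touched i.1) && (i.2.2 \in touched i.1)).
pose F (x : I * J) : {set edge n} :=
  x.1.1 :|: walk_edges x.1.2.1 (rcons (tagged x.2) x.1.2.2).
pose g (x : I * J) : R := y ^+ #|x.1.1| * y ^+ (tag x.2).+1.
apply: (@le_trans _ _ (\sum_(x | Q x.1) g x)).
  apply: (ler_sum_cover (F := F)) => [x _|S /and3P[gS /eqP lS SD]].
    by rewrite mulr_ge0 ?exprn_ge0.
  have SN0 : S != set0 by rewrite -(level_eq0 neq_roots gS) lS.
  have [T [u [p [v [gT ear SE lE]]]]] := good_ear neq_roots gS SN0.
  have cS := cards_ear ear; rewrite -SE in cS.
  have pD : (size p < D)%N by lia.
  exists ((T, (u, v)), Tagged (fun m : 'I_D => (m : nat).-tuple 'I_n) (in_tuple p : (Ordinal pD).-tuple 'I_n)).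
    rewrite /Q /= gT; have [lT] : (level T).+1 = j.+1 by rewrite -lE.
    rewrite lT eqxx; case/and5P: ear => -> -> _ _ _; rewrite !andbT /=.
    by apply: leq_trans SD; rewrite cS leq_addr.
  by split; rewrite ?SE // /g /= -exprD -cS SE.
rewrite (eq_bigl (fun x : I * J => Q x.1 && true)) => [|x]; last by rewrite andbT.
rewrite -(pair_big_dep Q (fun _ : I => predT : pred J) (fun (i : I) (x : J) => y ^+ #|i.1| * y ^+ (tag x).+1)) /=.
have inner : \sum_(x : J) y ^+ (tag x).+1 = path_sum.
  rewrite -(@sig_big_dep _ _ _ _ (fun m : 'I_D => (m : nat).-tuple 'I_n) predT (fun _ => predT)
    (fun (m : 'I_D) _ => y ^+ m.+1)) /=.
  apply: eq_bigr => m _; rewrite sumr_const card_tuple card_ord -[LHS]mulr_natl.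
  by rewrite natrX.
under eq_bigr => i _ do rewrite -mulr_sumr inner.
rewrite -mulr_suml [leRHS]mulrAC; apply: ler_wpM2r; first exact: path_sum_ge0.
rewrite /level_sum mulr_sumr.
rewrite -(pair_big_dep (fun T : {set edge n} => [&& good T, level T == j & (#|T| <= D)%N])
  (fun T (p : 'I_n * 'I_n) => (p.1 \in touched T) && (p.2 \in touched T))
  (fun T _ => y ^+ #|T|)) /=.
apply: ler_sum => T /and3P[gT /eqP lT TD].
rewrite -(pair_big (mem (touched T)) (mem (touched T)) (fun _ _ => y ^+ #|T|)) /=.
rewrite !sumr_const -mulrnA -[leLHS]mulr_natl; apply: ler_wpM2r; first by rewrite exprn_ge0.
by rewrite expr2 -natrM ler_nat leq_mul // bP.
Qed.

(** At level 0 only the two roots are touched, so that the constant for the first ear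
    does not depend on D; later a good set with at most D edges touches at most D + 1
    vertices. *)
Lemma level_sum_le j : level_sum j.+1 <=
  4 * path_sum * ((D.+1)%:R ^+ 2 * path_sum) ^+ j.
Proof.
elim: j => [|j IH].
  rewrite expr0 mulr1; apply: le_trans (level_sum_step (b := 2) _) _.
    move=> T gT /eqP; rewrite level_eq0 // => /eqP ->.
    by rewrite (card_touched0 neq_roots).
  by rewrite level_sum0 mulr1 -natrX.
apply: le_trans (level_sum_step (b := D.+1) _) _.
  by move=> T gT lT TD; have := card_touched neq_roots gT; lia.
rewrite [_ ^+ j.+1]exprS [leRHS]mulrCA; apply: ler_wpM2l => //.
by rewrite mulr_ge0 ?sqr_ge0 ?path_sum_ge0.
Qed.

Lemma sum_by_level B : 0 <= B ->
  \sum_(T : {set edge n} | [&& good T, T != set0 & (#|T| <= D)%N])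
     B ^+ (level T).-1 * y ^+ #|T| = \sum_(j < D) B ^+ j * level_sum j.+1.
Proof.
move=> B0.
have lvD T : [&& good T, T != set0 & (#|T| <= D)%N] -> ((level T).-1 < D)%N.
  case/and3P => gT TN0 TD; have := level_le_card neq_roots gT.
  move: TN0; rewrite -(level_eq0 neq_roots gT); case: (level T) => [|l _ lT]; [by rewrite eqxx|exact: leq_trans lT TD].
case DE : D lvD => [|D'] lvD.
  rewrite big_ord0 big_pred0 // => T; apply/negP => H; by have := lvD T H.
rewrite (partition_big (fun T => inord (level T).-1 : 'I_D'.+1) predT) //=.
apply: eq_bigr => j _; rewrite /level_sum DE mulr_sumr.
apply: eq_big => [T|T /andP[H /eqP <-]]; last by rewrite inordK // lvD.
have [gT|] := boolP (good T); last by rewrite ?andbF.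
rewrite /= -(level_eq0 neq_roots gT) andbC -val_eqE /=.
have [TD|_] := boolP (#|T| <= D'.+1)%N; last by do !case: (_ == _).
rewrite !andbT; have := level_le_card neq_roots gT.
case: (level T) => [|l] lT /=; first by rewrite andbF.
by rewrite andbT inordK ?eqSS //; lia.
Qed.

(** For D <= 1 the sum has at most one term; the geometric decay is needed only from
    the second level on. *)
Lemma sum_by_level_le B : 0 <= B ->
  ((1 < D)%N -> B * ((D.+1)%:R ^+ 2 * path_sum) <= 2^-1) ->
  \sum_(T : {set edge n} | [&& good T, T != set0 & (#|T| <= D)%N])
     B ^+ (level T).-1 * y ^+ #|T| <= 8 * path_sum.
Proof.
move=> B0 small; rewrite sum_by_level //.
have g0 := path_sum_ge0; have s0 : 0 <= B * ((D.+1)%:R ^+ 2 * path_sum).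
  by rewrite mulr_ge0 // mulr_ge0 ?sqr_ge0.
apply: (@le_trans _ _ (\sum_(j < D) 4 * path_sum * (2^-1) ^+ j)).
  apply: ler_sum => j _; apply: le_trans (ler_wpM2l _ (level_sum_le j)) _; first exact: exprn_ge0.
  rewrite mulrCA; apply: ler_wpM2l; first by rewrite mulr_ge0.
  rewrite -exprMn; case: j => -[|j] jD /=; first by rewrite !expr0.
  by apply: lerXn2r; rewrite ?nnegrE ?invr_ge0 // small //; lia.
rewrite -mulr_sumr (_ : 8 * path_sum = 4 * path_sum * 2); last by ring.
apply: ler_wpM2l; first by rewrite mulr_ge0.
suff -> : \sum_(j < D) (2^-1 : R) ^+ j = 2 - 2 * 2^-1 ^+ D.
  by rewrite lerBlDr lerDl mulr_ge0 ?exprn_ge0 ?invr_ge0.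
elim: D => [|d IH]; first by rewrite big_ord0 expr0; ring.
by rewrite big_ord_recr IH /= exprS; field.
Qed.
End Counting.

(** * The block model and the certificate *)

Section Model.
Variables (R : realType) (n q : nat) (a b : R).
Hypothesis n_gt0 : (0 < n)%N.
Local Notation Lab := {ffun 'I_n -> 'I_q.+1}.
Local Notation k := (q.+1%:R : R).
Implicit Types (e : edge n) (S T A : {set edge n}) (s : Lab) (w : outcome n q.+1).

(** The edge probability averaged over the labelings by q.+1 communities. *)
Definition mean_prob : R := (a + q%:R * b) / (k * n%:R).
Definition contrast : R := (a - b) / n%:R.
Definition mean_var : R := (a * (1 - a / n%:R) + q%:R * (b * (1 - b / n%:R))) / (k * n%:R).
Definition contrast_var : R := (a * (1 - a / n%:R) - b * (1 - b / n%:R)) / n%:R.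

Let nN0 : n%:R != 0 :> R. Proof. by rewrite pnatr_eq0 -lt0n. Qed.
Let kE : k = q%:R + 1. Proof. by rewrite -natr1. Qed.
Let kN0 : q%:R + 1 != 0 :> R. Proof. by rewrite -kE pnatr_eq0. Qed.

Lemma edge_probE s e : edge_prob a b s e = mean_prob + contrast * eagree R e s.
Proof.
rewrite /edge_prob /mean_prob /contrast /eagree /cagree /agree kE.
by case: eqP => _ /=; field; rewrite nN0 kN0.
Qed.

Lemma edge_varE s e : edge_prob a b s e * (1 - edge_prob a b s e) =
  weight mean_var contrast_var e s.
Proof.
rewrite /edge_prob /weight /mean_var /contrast_var /eagree /cagree /agree kE.
by case: eqP => _ /=; field; rewrite nN0 kN0.
Qed.

Local Notation E := (@sbm_expect R n q.+1 a b).

Definition graph_mean s (X : graph n -> R) : R :=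
  \sum_(Y : graph n)
    (\prod_e (if Y e then edge_prob a b s e else 1 - edge_prob a b s e)) * X Y.

Lemma sbm_expectE (X : outcome n q.+1 -> R) :
  E X = avg (fun s => graph_mean s (fun Y => X (s, Y))).
Proof.
transitivity (\sum_(s : Lab) \sum_(Y : graph n) sbm_pmf a b (s, Y) * X (s, Y)).
  by rewrite pair_bigA; apply: eq_bigr => -[].
rewrite /avg mulr_sumr; apply: eq_bigr => s _.
rewrite /graph_mean mulr_sumr; apply: eq_bigr => Y _.
by rewrite /sbm_pmf /= prodr_const card_ord exprVn mulrA.
Qed.

Lemma graph_mean_prod s (h : edge n -> bool -> R) :
  graph_mean s (fun Y => \prod_e h e (Y e)) =
  \prod_e (edge_prob a b s e * h e true + (1 - edge_prob a b s e) * h e false).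
Proof.
transitivity (\prod_e \sum_(y : bool)
    (if y then edge_prob a b s e else 1 - edge_prob a b s e) * h e y); last first.
  by apply: eq_bigr => e _; rewrite big_bool.
by rewrite bigA_distr_bigA; apply: eq_bigr => Y _; rewrite big_split.
Qed.

Definition centered S w : R := \prod_(e in S) ((w.2 e)%:R - mean_prob).
Definition noise T w : R := \prod_(e in T) ((w.2 e)%:R - edge_prob a b w.1 e).

Lemma graph_mean_ext s (X X' : graph n -> R) : X =1 X' ->
  graph_mean s X = graph_mean s X'.
Proof. by move=> XX; apply: eq_bigr => Y _; rewrite XX. Qed.

(** Given the labels the edges are independent. The factor of an edge in T but not in
    S is centered, hence the vanishing unless T is contained in S; an edge of T
    contributes its variance and an edge of S minus T its conditional mean offset. *)
Lemma graph_mean_centered_noise s S T :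
  graph_mean s (fun Y => centered S (s, Y) * noise T (s, Y)) =
  if T \subset S then
    contrast ^+ #|S :\: T| * (weights mean_var contrast_var T s * eagrees R (S :\: T) s)
  else 0.
Proof.
pose h e y : R := (if e \in S then (y : bool)%:R - mean_prob else 1)
  * (if e \in T then y%:R - edge_prob a b s e else 1).
rewrite (@graph_mean_ext s _ (fun Y => \prod_e h e (Y e))) => [|Y]; last first.
  by rewrite big_split /= -!big_mkcond.
rewrite graph_mean_prod; case: ifP => [TS|nTS]; last first.
  have [e eT eS] := subsetPn (negbT nTS).
  by rewrite (bigD1 e) //= /h (negPf eS) eT /=; ring.
rewrite /eagrees /weights -prodr_const mulrCA -big_split /= [X in X * _]big_mkcond [X in _ * X]big_mkcond.
rewrite -big_split; apply: eq_bigr => e _ /=; rewrite /h in_setD.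
have := subsetP TS e; case: (e \in T) => [/(_ isT) ->|_] /=.
  by rewrite -edge_varE /=; ring.
by case: (e \in S); rewrite ?edge_probE /=; ring.
Qed.

Lemma graph_mean_noise_noise s T T' :
  graph_mean s (fun Y => noise T (s, Y) * noise T' (s, Y)) =
  if T == T' then weights mean_var contrast_var T s else 0.
Proof.
pose h e y : R := (if e \in T then (y : bool)%:R - edge_prob a b s e else 1)
  * (if e \in T' then y%:R - edge_prob a b s e else 1).
rewrite (@graph_mean_ext s _ (fun Y => \prod_e h e (Y e))) => [|Y]; last first.
  by rewrite big_split /= -!big_mkcond.
rewrite graph_mean_prod; case: eqP => [TT|/eqP nTT].
  rewrite /weights [RHS]big_mkcond; apply: eq_bigr => e _; rewrite /h -TT.
  by case: (e \in T); rewrite -?edge_varE /=; ring.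
have [e eTT] : exists e, (e \in T) != (e \in T').
  apply/existsP; rewrite -[X in is_true X]negbK negb_exists; apply/negP => /forallP H.
  by move/eqP: nTT; apply; apply/setP => e; apply/eqP; rewrite -[_ == _]negbK.
by rewrite (bigD1 e) //= /h; move: eTT; case: (e \in T); case: (e \in T') => // _ /=; ring.
Qed.

Lemma expectD (X X' : outcome n q.+1 -> R) : E (fun w => X w + X' w) = E X + E X'.
Proof. by rewrite /sbm_expect -big_split; apply: eq_bigr => w _; rewrite mulrDr. Qed.

Lemma expectZ c (X : outcome n q.+1 -> R) : E (fun w => c * X w) = c * E X.
Proof. by rewrite /sbm_expect mulr_sumr; apply: eq_bigr => w _; rewrite mulrCA. Qed.

Lemma expect_sum (I : Type) (l : seq I) (P : pred I) (X : I -> outcome n q.+1 -> R) :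
  E (fun w => \sum_(i <- l | P i) X i w) = \sum_(i <- l | P i) E (X i).
Proof.
by rewrite /sbm_expect exchange_big; apply: eq_bigr => w _; rewrite mulr_sumr.
Qed.

Lemma expect_ext (X X' : outcome n q.+1 -> R) : X =1 X' -> E X = E X'.
Proof. by move=> XX; apply: eq_bigr => w _; rewrite XX. Qed.

Lemma expect_centered_noise S T :
  E (fun w => centered S w * noise T w) =
  if T \subset S then moment q contrast mean_var contrast_var S T else 0.
Proof.
rewrite sbm_expectE (avg_ext (fun s => graph_mean_centered_noise s S T)).
by case: ifP => _; [rewrite avgZ|rewrite avg_cst].
Qed.

Lemma expect_noise_noise T T' :
  E (fun w => noise T w * noise T' w) =
  if T == T' then avg (@weights R n q mean_var contrast_var T) else 0.
Proof.
rewrite sbm_expectE (avg_ext (fun s => graph_mean_noise_noise s T T')).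
by case: ifP => _ //; rewrite avg_cst.
Qed.

Lemma expect_labels (F : Lab -> R) : E (fun w => F w.1) = avg F.
Proof.
rewrite sbm_expectE; apply: avg_ext => s /=.
transitivity (graph_mean s (fun Y => F s * (centered set0 (s, Y) * noise set0 (s, Y)))).
  by apply: graph_mean_ext => Y; rewrite /centered /noise !big_set0 !mulr1.
transitivity (F s * graph_mean s (fun Y => centered set0 (s, Y) * noise set0 (s, Y))).
  by rewrite /graph_mean mulr_sumr; apply: eq_bigr => Y _; rewrite mulrCA.
rewrite graph_mean_centered_noise subxx setDv cards0 /weights /eagrees !big_set0.
by rewrite !mulr1.
Qed.

Lemma expect_centered_labels S (F : Lab -> R) :
  E (fun w => centered S w * F w.1) =
  contrast ^+ #|S| * avg (fun s => F s * eagrees R S s).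
Proof.
rewrite sbm_expectE -avgZ; apply: avg_ext => s /=.
transitivity (F s * graph_mean s (fun Y => centered S (s, Y) * noise set0 (s, Y))).
  rewrite /graph_mean mulr_sumr; apply: eq_bigr => Y _.
  by rewrite /noise big_set0 mulr1; ring.
rewrite graph_mean_centered_noise sub0set setD0 /weights big_set0 mul1r.
exact: mulrCA.
Qed.

Variables (r r' : 'I_n) (D : nat) (u : {set edge n} -> R).
Local Notation good := (good r r').
Hypothesis uP : forall S,
  \sum_(T : {set edge n} | (T \subset S) && good T)
    moment q contrast mean_var contrast_var S T * u T = target q r r' contrast S.

Definition certificate w : R :=
  \sum_(T : {set edge n} | good T && (#|T| <= D)%N) u T * noise T w.

Local Notation x := (@same_community R n q.+1 r r').

Lemma expect_centered_residual S : (#|S| <= D)%N ->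
  E (fun w => centered S w * (x w - certificate w)) = 0.
Proof.
move=> SD; rewrite (@expect_ext _ (fun w => centered S w * cagree R r r' w.1 +
  \sum_(T : {set edge n} | good T && (#|T| <= D)%N) - u T * (centered S w * noise T w)));
  last first.
  move=> w; rewrite mulrBr /certificate mulr_sumr -sumrN; congr (_ + _).
  by apply: eq_bigr => T _; rewrite mulNr mulrCA.
rewrite expectD expect_sum expect_centered_labels -/(target q r r' contrast S) -uP.
rewrite big_mkcond [X in _ + X]big_mkcond -big_split /= big1 // => T _.
rewrite expectZ expect_centered_noise.
case gT: (good T); rewrite ?andbF /= ?addr0 //.
have [TS|] := boolP (T \subset S) => /=; last by case: ifP; rewrite ?mulr0 addr0.
rewrite (leq_trans (subset_leq_card TS) SD) mulNr [X in _ - X]mulrC; exact: subrr.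
Qed.

(** Expand each Y_e as (Y_e - mu) + mu, one edge at a time; S collects the edges
    already centered. *)
Lemma expect_monomial_residual A : (#|A| <= D)%N ->
  E (fun w => (\prod_(e in A) (w.2 e)%:R) * (x w - certificate w)) = 0.
Proof.
move=> AD; suff H m : forall A S, #|A| = m -> [disjoint A & S] -> (#|A| + #|S| <= D)%N ->
    E (fun w => (\prod_(e in A) (w.2 e)%:R) * (centered S w * (x w - certificate w))) = 0.
  have := H _ A set0 erefl; rewrite cards0 addn0 => /(_ _ AD) <-.
    by apply: expect_ext => w; rewrite /centered big_set0 mul1r.
  by rewrite disjoint_sym disjoints_subset sub0set.
elim: m => [|m IH] {AD}A S.
  move=> /eqP; rewrite cards_eq0 => /eqP -> _; rewrite cards0 => SD.
  rewrite -(expect_centered_residual SD); apply: expect_ext => w.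
  by rewrite big_set0 mul1r.
move=> cA dAS AD; have /card_gt0P[e eA] : (0 < #|A|)%N by rewrite cA.
have cA' : #|A :\ e| = m by have := cardsD1 e A; rewrite eA cA => -[].
have eS : e \notin S.
  by move/pred0P: dAS => /(_ e) /=; rewrite eA /= => ->.
have dA'S : [disjoint A :\ e & S] by apply: disjointWl dAS; rewrite subD1set.
rewrite (@expect_ext _ (fun w =>
    (\prod_(i in A :\ e) (w.2 i)%:R) * (centered (e |: S) w * (x w - certificate w)) +
    mean_prob * ((\prod_(i in A :\ e) (w.2 i)%:R) * (centered S w * (x w - certificate w)))));
  last first.
  move=> w; rewrite (big_setD1 e eA) /= [centered (e |: S) w]big_setU1 //= -/(centered S w).
  move: (\prod_(i in _) _) (centered S w) (x w - _) => *; ring.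
rewrite expectD expectZ !IH ?mulr0 ?addr0 //.
- by rewrite cA'; rewrite cA in AD; lia.
- apply/pred0P => z /=; rewrite !inE; case: eqP => //= _.
  by move/pred0P: dAS => /(_ z).
- by rewrite cA' cardsU1 eS; rewrite cA in AD; lia.
Qed.

(** On 0/1 variables each monomial is the product of the variables in its support,
    whose size is at most the degree. *)
Lemma expect_poly_residual (f : edge_poly R n) : edge_poly_degree_le D f ->
  E (fun w => edge_poly_eval f w.2 * x w) = E (fun w => edge_poly_eval f w.2 * certificate w).
Proof.
move=> fD; apply/eqP; rewrite -subr_eq0 -mulN1r -expectZ -expectD; apply/eqP.
rewrite (@expect_ext _ (fun w => \sum_(m <- mpoly.msupp f) mpoly.mcoeff m f *
   (\prod_(e in [set enum_val i | i : 'I_#|{: edge n}| & mpoly.fun_of_multinom m i != 0]) (w.2 e)%:R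
     * (x w - certificate w)))); last first.
  move=> w.
  transitivity (edge_poly_eval f w.2 * (x w - certificate w)); first by ring.
  rewrite /edge_poly_eval mpoly.mevalE mulr_suml; apply: eq_bigr => m _.
  rewrite -mulrA; congr (_ * (_ * _)).
  rewrite big_imset /=; last by move=> i j _ _; apply: enum_val_inj.
  rewrite [RHS]big_mkcond; apply: eq_bigr => i _; rewrite inE.
  by case: (mpoly.fun_of_multinom m i) => [|d] //=; case: (w.2 _); rewrite ?expr1n ?expr0n.
rewrite expect_sum big1_seq // => m /andP[_ mf]; rewrite expectZ expect_monomial_residual ?mulr0 //.
apply: leq_trans (leq_imset_card _ _) _.
have := mpoly.msize_mdeg_lt mf; move/leq_trans => /(_ _ fD); rewrite ltnS; apply: leq_trans.
rewrite mpoly.mdegE -sum1_card big_mkcond; apply: leq_sum => i _; rewrite inE.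
by case: (mpoly.fun_of_multinom m i).
Qed.

Lemma expect_certificate_sqr : E (fun w => certificate w ^+ 2) =
  \sum_(T : {set edge n} | good T && (#|T| <= D)%N)
     u T ^+ 2 * avg (@weights R n q mean_var contrast_var T).
Proof.
rewrite (@expect_ext _ (fun w => \sum_(T : {set edge n} | good T && (#|T| <= D)%N)
   \sum_(T' : {set edge n} | good T' && (#|T'| <= D)%N) u T * u T' * (noise T w * noise T' w)));
  last first.
  move=> w; rewrite expr2 /certificate mulr_suml; apply: eq_bigr => T _.
  by rewrite mulr_sumr; apply: eq_bigr => T' _; rewrite mulrACA.
rewrite expect_sum; apply: eq_bigr => T PT; rewrite expect_sum (bigD1 T) //=.
rewrite expectZ expect_noise_noise eqxx big1 ?addr0 // => T' /andP[_ TT'].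
by rewrite expectZ expect_noise_noise eq_sym (negPf TT') mulr0.
Qed.

Hypotheses (a_prob : 0 <= a <= n%:R) (b_prob : 0 <= b <= n%:R).

Lemma edge_prob_bounds s e : 0 <= edge_prob a b s e <= 1.
Proof.
have n0 : 0 < n%:R :> R by rewrite ltr0n.
have [/andP[a0 an] /andP[b0 bn]] := (a_prob, b_prob).
by rewrite /edge_prob; case: ifP => _; rewrite divr_ge0 ?(ltW n0) //= ler_pdivrMr // mul1r.
Qed.

Lemma expect_ge0 (X : outcome n q.+1 -> R) : (forall w, 0 <= X w) -> 0 <= E X.
Proof.
move=> X0; apply: sumr_ge0 => w _; apply: mulr_ge0 => //; apply: mulr_ge0.
  by apply: prodr_ge0 => _ _; rewrite invr_ge0 ler0n.
apply: prodr_ge0 => e _; have /andP[p0 p1] := edge_prob_bounds w.1 e.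
by case: ifP => _ //; rewrite subr_ge0.
Qed.

(** Expand E[(A Z - B X)^2] >= 0 with A = E[X^2] and B = E[X Z]. *)
Lemma expect_Cauchy_Schwarz (X Z : outcome n q.+1 -> R) : 0 < E (fun w => X w ^+ 2) ->
  E (fun w => X w * Z w) ^+ 2 <= E (fun w => X w ^+ 2) * E (fun w => Z w ^+ 2).
Proof.
set A := E _; set B := E _; set G := E _ => A0.
have : 0 <= E (fun w => (A * Z w - B * X w) ^+ 2) by apply: expect_ge0 => w; exact: sqr_ge0.
rewrite (@expect_ext _ (fun w => A ^+ 2 * (Z w ^+ 2) +
  (- (2 * A * B) * (X w * Z w) + B ^+ 2 * X w ^+ 2))) => [|w]; last by ring.
rewrite expectD expectD !expectZ -/A -/B -/G => H.
rewrite -subr_ge0 -(pmulr_rge0 _ A0).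
by have -> : A * (A * G - B ^+ 2) = A ^+ 2 * G + (- (2 * A * B) * B + B ^+ 2 * A) by ring.
Qed.

Lemma corr_le_certificate (C : R) : 0 <= C ->
  E (fun w => certificate w ^+ 2) <= C ^+ 2 * E (fun w => x w ^+ 2) ->
  (corr_le q.+1 a b D r r' <= C%:E)%E.
Proof.
move=> C0 gC; rewrite /corr_le; apply: ub_ereal_sup => _ [f [fD fN0] <-].
rewrite lee_fin expect_poly_residual //.
have f0 : 0 < E (fun w => edge_poly_eval f w.2 ^+ 2).
  by rewrite lt_neqAle eq_sym fN0 expect_ge0 // => w; exact: sqr_ge0.
have x0 : 0 <= E (fun w => x w ^+ 2) by apply: expect_ge0 => w; exact: sqr_ge0.
have H := expect_Cauchy_Schwarz certificate f0.
set A := E _ in f0 H *; set B := E _ in H *; set X := E _ in x0 gC *.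
have [X0|Xp] := eqVneq X 0; first by rewrite X0 mulr0 sqrtr0 invr0 mulr0.
have {Xp} Xp : 0 < X by rewrite lt_neqAle eq_sym Xp.
rewrite ler_pdivrMr ?sqrtr_gt0 ?mulr_gt0 //.
apply: le_trans (ler_norm B) _; rewrite -sqrtr_sqr.
have -> : C * Num.sqrt (A * X) = Num.sqrt (C ^+ 2 * (A * X)).
  by rewrite [RHS]sqrtrM ?sqr_ge0 // sqrtr_sqr ger0_norm.
apply: ler_wsqrtr; rewrite mulrCA; apply: le_trans H _.
by apply: ler_wpM2l gC; exact: ltW.
Qed.
End Model.

(** * Bounds below the Kesten-Stigum threshold *)

Lemma geometric_sum_le (R : realFieldType) (eta z : R) (D : nat) :
  0 <= z -> z <= 1 - eta -> eta * (\sum_(m < D) z ^+ m) <= 1 - z ^+ D.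
Proof.
move=> z0 z1; elim: D => [|D IH]; first by rewrite big_ord0 mulr0 subrr.
rewrite big_ord_recr /= mulrDr exprS.
have zD : 0 <= z ^+ D by rewrite exprn_ge0.
have : eta * z ^+ D <= (1 - z) * z ^+ D by apply: ler_wpM2r => //; lra.
lra.
Qed.

Section NonAsymptotic.
Variables (R : realType) (n q : nat) (a b eta delta : R) (D : nat) (r r' : 'I_n).
Local Notation k := (q.+1%:R : R).
Hypotheses (neq_roots : r != r') (n_gt1 : (1 < n)%N) (q_gt0 : (0 < q)%N).
Hypotheses (a_gt0 : 0 < a) (b_gt0 : 0 < b) (b_le : b <= n%:R) (a_le : a <= n%:R / 2).
Hypotheses (delta_gt0 : 0 < delta) (ab : delta * b <= a).
Hypotheses (eta_gt0 : 0 < eta) (snr : SNR n q.+1 a b <= 1 - eta).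

Local Notation lam := (contrast n a b).
Local Notation v := (mean_var n q a b).
Local Notation kap := (contrast_var n a b).
Local Notation A := (a * (1 - a / n%:R)).
Local Notation B := (b * (1 - b / n%:R)).

Let n_gt0 : (0 < n)%N. Proof. exact: ltnW. Qed.
Let n0 : 0 < n%:R :> R. Proof. by rewrite ltr0n. Qed.
Let k0 : 0 < k. Proof. by rewrite ltr0n. Qed.
Let q1 : 1 <= q%:R :> R. Proof. by rewrite ler1n. Qed.
Let kE : k = q%:R + 1. Proof. by rewrite -natr1. Qed.

Let a_half : a / n%:R <= 1 / 2.
Proof. by rewrite ler_pdivrMr // mul1r mulrC. Qed.

Let b_one : b / n%:R <= 1.
Proof. by rewrite ler_pdivrMr // mul1r. Qed.

Let A_ge : a / 2 <= A.
Proof. by rewrite ler_pM2l //; move: a_half; lra. Qed.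

Let B_ge0 : 0 <= B.
Proof. by apply: mulr_ge0; [exact: ltW|rewrite subr_ge0]. Qed.

Let B_le : B <= b.
Proof. by rewrite ger_pMr // gerBl divr_ge0 // ltW. Qed.

Let S_gt0 : 0 < A + q%:R * B.
Proof.
have : 0 < a / 2 by rewrite divr_gt0.
have : 0 <= q%:R * B by rewrite mulr_ge0.
by move: A_ge; lra.
Qed.

Lemma mean_var_gt0 : 0 < v.
Proof. by rewrite divr_gt0 ?mulr_gt0. Qed.

(** When kap < 0, no edge variance is smaller than this fraction of the mean edge
    variance. *)
Definition var_ratio : R := Num.min 1 (delta / 2).
Local Notation d := var_ratio.

Lemma var_ratio_gt0 : 0 < d.
Proof. by rewrite lt_min ltr01 divr_gt0. Qed.

Lemma var_ratio_le1 : d <= 1.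
Proof. by rewrite ge_min lexx. Qed.

Let a_prob : 0 <= a <= n%:R.
Proof. by rewrite ltW //=; apply: le_trans a_le _; move: n0; lra. Qed.

Let b_prob : 0 <= b <= n%:R.
Proof. by rewrite ltW. Qed.

Lemma weight_prob_ge0 (e : edge n) (s : {ffun 'I_n -> 'I_q.+1}) : 0 <= weight v kap e s.
Proof.
rewrite -edge_varE //; have /andP[p0 p1] := edge_prob_bounds n_gt0 a_prob b_prob s e.
by rewrite mulr_ge0 // subr_ge0.
Qed.

(** Write A and B for the two edge variances times n. Here A < B, so the mean variance
    times n is at most B, and A >= a/2 >= delta b/2 >= delta B/2 because a <= n/2. *)
Lemma weight_ge_var_ratio (e : edge n) (s : {ffun 'I_n -> 'I_q.+1}) :
  kap < 0 -> d * v <= weight v kap e s.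
Proof.
rewrite /contrast_var pmulr_llt0 ?invr_gt0 // subr_lt0 => AB.
have -> : d * v = d * ((A + q%:R * B) / k) / n%:R.
  by rewrite /mean_var invfM !mulrA.
have avB : (A + q%:R * B) / k <= B.
  by rewrite ler_pdivrMr // kE; move: AB; nra.
have dB : d * ((A + q%:R * B) / k) <= d * B by rewrite ler_pM2l // var_ratio_gt0.
have dBB : d * B <= B.
  rewrite ger_pMl ?var_ratio_le1 //; apply: lt_trans AB; by apply: lt_le_trans A_ge; rewrite divr_gt0.
have dBA : d * B <= A.
  have d2 : d <= delta / 2 by rewrite ge_min lexx orbT.
  apply: le_trans A_ge; apply: le_trans (ler_wpM2r B_ge0 d2) _.
  have := ler_wpM2l (ltW delta_gt0) B_le; move: ab; lra.
rewrite -edge_varE // /edge_prob; case: ifP => _; rewrite [leRHS]mulrAC.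
  by rewrite ler_pM2r ?invr_gt0 //; apply: le_trans dB dBA.
by rewrite ler_pM2r ?invr_gt0 //; apply: le_trans dB dBB.
Qed.

Lemma weights_ge_ratio j S : ears r r' set0 j.+1 S ->
  v ^+ #|S| * d ^+ j <= avg (@weights R n q v kap S).
Proof.
have v0 := ltW mean_var_gt0; have d0 := ltW var_ratio_gt0; have d1 := var_ratio_le1.
move=> gS; have [kap0|kap0] := leP 0 kap.
  apply: le_trans (avg_weight_ge_pos q S v0 kap0).
  by rewrite ler_piMr ?exprn_ge0 // exprn_ile1.
apply: (avg_weight_ge_ears v0 _ _ gS); first by rewrite d0 d1.
by move=> e s; apply: weight_ge_var_ratio.
Qed.

Local Notation y := (lam ^+ 2 / (k ^+ 2 * v)).

(** The weight of an edge in the norm of the certificate is the signal-to-noise ratio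
    divided by n: a vertex has n possible neighbours. *)
Lemma edge_snrE : n%:R * y = SNR n q.+1 a b.
Proof.
rewrite /SNR /contrast /mean_var kE.
have kN0 : q%:R + 1 != 0 :> R by rewrite -kE lt0r_neq0.
have nN0 := lt0r_neq0 n0; have := lt0r_neq0 S_gt0.
have -> : q%:R + 1 - 1 = q%:R :> R by rewrite addrK.
rewrite -mulrA; move: A (b * (1 - b / n%:R)) => x x' xN0.
by field; rewrite kN0 nN0 xN0.
Qed.

Lemma edge_snr_ge0 : 0 <= y.
Proof.
by rewrite divr_ge0 ?sqr_ge0 // mulr_ge0 ?sqr_ge0 // ltW // mean_var_gt0.
Qed.

(** A geometric series with ratio SNR <= 1 - eta. *)
Lemma path_sum_le : path_sum n y D <= (n%:R * eta)^-1.
Proof.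
have z0 : 0 <= n%:R * y by rewrite mulr_ge0 ?edge_snr_ge0 // ltW.
have z1 : n%:R * y <= 1 - eta by rewrite edge_snrE.
have -> : path_sum n y D = n%:R^-1 * ((n%:R * y) * \sum_(m < D) (n%:R * y) ^+ m).
  rewrite /path_sum !mulr_sumr; apply: eq_bigr => m _.
  move: (lam ^+ 2 / _) => z; rewrite -exprS exprMn [n%:R ^+ m.+1]exprS -mulrA mulKf //.
  exact: lt0r_neq0.
have := geometric_sum_le D z0 z1; move: (n%:R * y) z0 z1 => z z0 z1 H.
rewrite invfM ler_wpM2l ?invr_ge0 ?(ltW n0) // -[leRHS]mul1r ler_pdivlMr // mulrC.
have zD : 0 <= z ^+ D by rewrite exprn_ge0.
have s0 : 0 <= \sum_(m < D) z ^+ m by apply: sumr_ge0 => m _; rewrite exprn_ge0.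
rewrite mulrCA; apply: (@le_trans _ _ (1 * (eta * \sum_(m < D) z ^+ m))); last by lra.
apply: ler_wpM2r; first by rewrite mulr_ge0 // ltW.
by rewrite (le_trans z1) // gerBl ltW.
Qed.

Lemma corr_le_nonasymptotic :
  ((1 < D)%N -> 72 * D%:R ^+ 4 * k ^+ 2 <= d * eta * n%:R) ->
  (corr_le q.+1 a b D r r' <= (8 / Num.sqrt eta * Num.sqrt (k / n%:R))%:E)%E.
Proof.
move=> large.
have v0 := mean_var_gt0; have d0 := var_ratio_gt0.
have W0 S : good r r' S -> avg (@weights R n q v kap S) != 0.
  move=> gS; apply: lt0r_neq0.
  exact: (weights_gt0 neq_roots v0 d0 weights_ge_ratio gS).

have [u uP] := certificate_exists lam neq_roots W0.
apply: (corr_le_certificate n_gt0 uP a_prob b_prob).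
  by rewrite mulr_ge0 ?sqrtr_ge0 // divr_ge0 ?sqrtr_ge0.
rewrite expect_certificate_sqr //.
have H := certificate_norm_le neq_roots D v0 d0 weight_prob_ge0 weights_ge_ratio uP.
apply: le_trans H _.
have B0 : 0 <= (1 + 2 * D%:R) ^+ 2 * k ^+ 2 / d.
  by apply: divr_ge0 (ltW d0); apply: mulr_ge0; apply: sqr_ge0.
have ps := path_sum_le.
apply: le_trans (ler_wpM2l _ (sum_by_level_le neq_roots edge_snr_ge0 B0 _)) _ => //.
  move=> D1; have {}large := large D1.
  apply: (@le_trans _ _ ((1 + 2 * D%:R) ^+ 2 * k ^+ 2 / d * (D.+1%:R ^+ 2 * (n%:R * eta)^-1))).
    by apply: ler_wpM2l => //; apply: ler_wpM2l ps; exact: sqr_ge0.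
  have -> : (1 + 2 * D%:R) ^+ 2 * k ^+ 2 / d * (D.+1%:R ^+ 2 * (n%:R * eta)^-1)
    = (((1 + 2 * D%:R) * D.+1%:R) ^+ 2 * k ^+ 2) / (d * eta * n%:R).
    move: (D.+1%:R : R) => x; field.
    by rewrite !lt0r_neq0.
  rewrite ler_pdivrMr ?mulr_gt0 //.
  have D1' : 1 <= D%:R :> R by rewrite ler1n ltnW.
  have DE : D.+1%:R = D%:R + 1 :> R by rewrite -natr1.
  have HD : ((1 + 2 * D%:R) * D.+1%:R) ^+ 2 <= 36 * D%:R ^+ 4 :> R.
    have -> : 36 * D%:R ^+ 4 = (6 * D%:R ^+ 2) ^+ 2 :> R by ring.
    rewrite DE ler_sqr ?nnegrE; [nra|nra|nra].
  have := ler_wpM2r (sqr_ge0 k) HD; move: large; move: (D%:R ^+ 4) => X; lra.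
apply: (@le_trans _ _ (4 * (8 * (n%:R * eta)^-1))).
  by apply: ler_wpM2l => //; apply: ler_wpM2l ps.
rewrite (expect_labels a b n_gt0 (fun s => cagree R r r' s ^+ 2)) avg_sqr_cagree //.
rewrite !exprMn exprVn !sqr_sqrtr ?(ltW eta_gt0) ?divr_ge0 ?(ltW n0) ?(ltW k0) //.
have kh : k^-1 <= 1 / 2.
  by rewrite -[_^-1]mul1r ler_pdivrMr // kE; move: q1; lra.
have -> : 8 ^+ 2 / eta * (k / n%:R) * (k^-1 * (1 - k^-1)) =
   64 * (1 - k^-1) * (n%:R * eta)^-1.
  by move: k k0 => K K0; field; rewrite !lt0r_neq0.
rewrite mulrA; apply: ler_wpM2r; first by rewrite invr_ge0 mulr_ge0 // ltW.
rewrite -subr_ge0 (_ : _ - _ = 64 * (1 / 2 - k^-1)); last by move: k^-1 => z; field.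
by rewrite mulr_ge0 // subr_ge0.
Qed.
End NonAsymptotic.

Theorem theorem1p3 (R : realType) :
  forall eta : R, 0 < eta ->
  exists C : R, 0 < C /\
  forall delta : R, 0 < delta ->
  exists c : R, 0 < c /\
  forall eps : R, 0 < eps ->
  forall (n q : nat) (a b : R) (D : nat) (hn : (1 < n)%N),
    (2 <= q)%N ->
    0 < a -> 0 < b -> b <= n%:R ->
    a <= n%:R / 2 ->
    q%:R <= n%:R `^ (2^-1 - eps) ->
    delta * b <= a ->
    SNR n q a b <= 1 - eta ->
    D%:R <= n%:R `^ (c * eps) ->
    (corr_le q a b D (Ordinal (ltnW hn)) (Ordinal hn)
       <= (C * Num.sqrt (q%:R / n%:R))%:E)%E.
Proof.
move=> eta eta0; exists (8 / Num.sqrt eta); split; first by rewrite divr_gt0 ?sqrtr_gt0.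
move=> delta delta0.
pose d := var_ratio delta; have d0 : 0 < d := var_ratio_gt0 delta0.
have x0 : 0 <= 72 / (d * eta) by rewrite divr_ge0 // mulr_ge0 // ltW.
(* The exponent K absorbs the constant 72 / (d eta) into D^K once D >= 2; four more
   powers of D come from the counting of ears and chains. *)
pose K := Num.bound (72 / (d * eta)).
have KP : 72 <= d * eta * 2 ^+ K.
  rewrite mulrC -ler_pdivrMr ?mulr_gt0 //; apply: le_trans (ltW (archi_boundP x0)) _.
  by rewrite -natrX ler_nat ltnW // ltn_expl.
exists (2 / (K + 4)%:R); split; first by rewrite divr_gt0 // ltr0n addnS.
move=> eps eps0 n [//|q] a b D hn q2 a0 b0 bn an qn ab snr Dn.
have n0 : 0 < n%:R :> R by rewrite ltr0n ltnW.
apply: (corr_le_nonasymptotic (delta := delta)) => // D1.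
have Dle : D%:R ^+ (K + 4) <= n%:R `^ (2 * eps).
  have -> : 2 * eps = 2 / (K + 4)%:R * eps * (K + 4)%:R.
    by rewrite mulrAC divfK // pnatr_eq0 addnS.
  rewrite powRrM powR_mulrn ?powR_ge0 //.
  by apply: lerXn2r; rewrite ?nnegrE ?powR_ge0.
have qle : q.+1%:R ^+ 2 <= n%:R `^ (1 - 2 * eps).
  have -> : 1 - 2 * eps = (2^-1 - eps) * 2%:R by lra.
  rewrite powRrM powR_mulrn ?powR_ge0 //.
  by apply: lerXn2r; rewrite ?nnegrE ?powR_ge0.
(* The factor n^(2 eps) pays for D^(K + 4), the factor n^(1 - 2 eps) for the square of
   the number of communities. *)
have nE : n%:R = n%:R `^ (2 * eps) * n%:R `^ (1 - 2 * eps) :> R.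
  rewrite -powRD; last by rewrite (lt0r_neq0 n0) implybT.
  by rewrite addrC subrK powRr1 // ltW.
have Kn : 2 ^+ K * D%:R ^+ 4 * q.+1%:R ^+ 2 <= n%:R :> R.
  rewrite nE; apply: ler_pM => //; rewrite ?mulr_ge0 ?exprn_ge0 ?ler0n //.
  apply: le_trans Dle; rewrite exprD; apply: ler_wpM2r; first by rewrite exprn_ge0.
  by apply: lerXn2r; rewrite ?nnegrE // ler_nat.
apply: le_trans (ler_wpM2l _ Kn); last by rewrite mulr_ge0 // ltW.
have -> : d * eta * (2 ^+ K * D%:R ^+ 4 * q.+1%:R ^+ 2) =
    d * eta * 2 ^+ K * (D%:R ^+ 4 * q.+1%:R ^+ 2) by rewrite !mulrA.
by rewrite -mulrA; apply: ler_wpM2r KP; rewrite mulr_ge0 ?exprn_ge0.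
Qed.
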